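(* Let $\alpha\in(0,1)$, let $f_\alpha$ be the Manneville-Pomeau (Liverani-Saussol-Vaienti) map on $[0,1]$ and let $\mu_\alpha$ be its absolutely continuous invariant probability measure. Let $\zeta=0$, let $\varphi$ be an observable with unique maximum at $\zeta=0$ as described in the context, let $X_i=\varphi\circ f_\alpha^i$ for $i\ge0$, and let $M_n=\max\{X_0,\dots,X_{n-1}\}$. (a) If $\tau>0$ and $(u_n)_n$ is a sequence of levels with $\lim_{n\to\infty}n\,\mu_\alpha(X_0>u_n)=\tau$, then $\lim_{n\to\infty}\mu_\alpha(M_n\le u_n)=1$. (b) Suppose $\alpha\in(0,\sqrt5-2)$ and $\tau\ge0$, and let $(u_n)_n$ be a sequence of thresholds satisfying $$\lim_{n\to\infty}n\,\mu_\alpha\big([x_n,\varphi^{-1}(u_n))\big)=\tau,$$ where $x_n$ is such that $x_n<\varphi^{-1}(u_n)$ and $f_\alpha(x_n)=\varphi^{-1}(u_n)$. Then $$\lim_{n\to\infty}\mu_\alpha(M_n\le u_n)=e^{-\tau}.$$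
   Context: The map: for $\alpha\in(0,1)$, $f_\alpha:[0,1]\to[0,1]$ is given by $f_\alpha(x)=x(1+2^\alpha x^\alpha)$ for $x\in[0,1/2)$ and $f_\alpha(x)=2x-1$ for $x\in[1/2,1]$. The point $0$ is an indifferent fixed point. The map has an invariant probability measure $\mu_\alpha$ that is absolutely continuous with respect to Lebesgue measure (acip). The observable: $\varphi:[0,1]\to\mathbb{R}\cup\{+\infty\}$ is a function of the distance to $\zeta=0$, attaining its unique maximum $u_\varphi=\varphi(0)$ (possibly $+\infty$) at $0$, continuous, strictly decreasing and hence invertible in a neighbourhood of $0$. For $u<u_\varphi$ sufficiently close to $u_\varphi$, $\varphi^{-1}(u)$ denotes the value of the inverse of this restriction of $\varphi$ near $0$, and $\{X_0>u\}=\{\varphi>u\}=[0,\varphi^{-1}(u))$. Examples are $\varphi(x)=-\log x$ and $\varphi(x)=1-x$. The levels $u_n$ are taken close enough to $u_\varphi$ for $\varphi^{-1}(u_n)$ to be defined. *)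

(* Defs.v *)
From HB Require Import structures.
From mathcomp Require Import all_boot all_order all_algebra.
From mathcomp Require Import all_classical all_reals all_analysis.

Set Implicit Arguments.
Unset Strict Implicit.
Unset Printing Implicit Defensive.

Import Order.TTheory GRing.Theory Num.Theory.
Import numFieldNormedType.Exports.

Local Open Scope classical_set_scope.
Local Open Scope ring_scope.

(* The phase space [0, 1] is the subset `[0, 1] of the
   realType R: maps and observables are total functions on R whose values
   outside `[0, 1] are irrelevant, and every event below is intersected with
   `[0, 1]. *)

Section MannevillePomeau.
Context {R : realType}.

Definition lsv (alpha x : R) : R :=
  if x < 1 / 2 then x * (1 + 2 `^ alpha * x `^ alpha) else 2 * x - 1.

Definition acip (f : R -> R) (mu : probability (measurableTypeR R) R) : Prop :=
  [/\ mu `[0, 1]%classic = 1%E,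
      mu `<< @lebesgue_measure R
    & forall A : set (measurableTypeR R), measurable A ->
        mu (`[0, 1]%classic `&` f @^-1` A) = mu A].

(* The inverse of the restriction of phi to the neighbourhood `[0, delta[ of 0
   in `[0, 1]; it takes the value 0 off phi @` `[0, delta[. *)
Definition obs_inv (phi : R -> \bar R) (delta u : R) : R :=
  'pinv_(fun=> 0) `[0, delta[%classic phi u%:E.

Definition exceedance (phi : R -> \bar R) (u : R) : set (measurableTypeR R) :=
  [set x | x \in `[0, 1] /\ (u%:E < phi x)%E].

(* Being a function of the distance |x - 0| is automatic on `[0, 1].
   Continuity is only required on `[0, delta[; it includes continuity at 0
   for the topology of \bar R when phi 0 = +oo. *)
Record observable (phi : R -> \bar R) (delta : R) : Prop := Observable {
  obs_delta : 0 < delta <= 1 ;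
  obs_ninfty : forall x : R, x \in `[0, 1] -> phi x != -oo%E ;
  obs_max : forall x : R, x \in `]0, 1] -> (phi x < phi 0%R)%E ;
  obs_continuous : {within `[0, delta[%classic, continuous phi} ;
  obs_decreasing : forall x y : R, x \in `[0, delta[ -> y \in `[0, delta[ ->
    x < y -> (phi y < phi x)%E ;
  obs_exceedance : exists2 u0 : R, (u0%:E < phi 0%R)%E &
    forall u : R, u0 < u -> (u%:E < phi 0%R)%E ->
      exceedance phi u = `[0, obs_inv phi delta u[%classic }.

(* The levels for which obs_inv phi delta u is the value of a genuine inverse
   and bounds the exceedance interval; by obs_exceedance these include every
   u < phi 0 sufficiently close to phi 0. *)
Definition level (phi : R -> \bar R) (delta u : R) : Prop :=
  [/\ (u%:E < phi 0%R)%E,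
      (phi @` `[0, delta[%classic) u%:E
    & exceedance phi u = `[0, obs_inv phi delta u[%classic].

Definition proc (f : R -> R) (phi : R -> \bar R) (i : nat) (x : R) : \bar R :=
  phi (iter i f x).

Definition max_proc (f : R -> R) (phi : R -> \bar R) (n : nat) (x : R) :
    \bar R :=
  \big[maxe/-oo%E]_(i < n) proc f phi i x.

Definition max_le (f : R -> R) (phi : R -> \bar R) (n : nat) (u : R) :
    set (measurableTypeR R) :=
  [set x | x \in `[0, 1] /\ (max_proc f phi n x <= u%:E)%E].

End MannevillePomeau.

(* Main.v *)
(* The set [0, b[ can be entered only through the gate [1/2, (1 + b)/2[, and by
   invariance the gate has the measure of [x, b[, where x is the left preimage of
   b; so, up to the event {X_0 > u_n}, the theorem is about avoiding a small gate
   up to time n.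

   The measure of [0, b[ is the sum of those of the gates of all left preimages
   of b, hence large compared with that of the gate of b, which gives (a).

   For (b) let p_n be the probability of avoiding the gate up to time n and m the
   measure of the gate.  By invariance p_n - p_(n+1) is the probability of
   starting in the gate and avoiding it afterwards.  If this is m (p_n + o(1))
   uniformly in n as b tends to 0, then p_n = (1 - m)^n + o(1), which tends to
   exp (- tau).  So mu conditioned on the gate and mu itself must have
   nearly the same avoidance probabilities.  Both become, when first visiting
   [1/2, 1[, laws whose density g is regular, i.e. ln g is Lipschitz in ln x.  For
   these a Doeblin argument works: under the return map to [1/2, 1[ every regular
   density dominates a fixed multiple of the uniform one and leaves a regular
   remainder, and the avoidance probabilities hardly change along the return
   because time shifts are harmless for rare events.

   That mu is a limit of regular laws follows from absolute continuity and
   invariance: mu is close to a law with Lipschitz density, and pushing the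
   latter forward makes it regular since the right branch halves the Lipschitz
   constant of ln g. *)

Require Import Defs.
From HB Require Import structures.
From mathcomp Require Import all_boot all_order all_algebra.
From mathcomp Require Import all_classical all_reals all_analysis measurable_realfun.
From mathcomp Require Import ring lra zify.

Set Implicit Arguments.
Unset Strict Implicit.
Unset Printing Implicit Defensive.

Import Order.TTheory GRing.Theory Num.Theory.
Import numFieldNormedType.Exports.

Local Open Scope classical_set_scope.
Local Open Scope ring_scope.

(** * Change of variables *)

(** The estimates for regular densities are uniform in the density; this is what lets them pass to
    mu, of whose density nothing explicit is known. The drop p_n - p_(n+1) is of order m and about 1
    / m such drops add up, so the error in each must be small relative to m. No approximation of mu
    chosen in advance achieves this for ever smaller gates; instead b is fixed and the approximation
    error is then sent to 0. For p_n itself an absolute error suffices.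

    No mixing rate enters. A shift by j steps costs O(j b), because Lebesgue measure stays regular
    under iteration and so gives every preimage of the gate at most 4 b. Mass leaving the gate lands
    in [0, b[, close to the fixed point; it is waited for during J steps with J b still small.

    Regularity is scale invariant and so tolerates a pole at 0. The left branch preserves it from
    the exponent 2 on, the right branch halves the exponent. Hence the pair 2 and 4: a 4-regular
    density comes back 2-regular, and the room between the two pays for the constant subtracted in
    the Doeblin step. *)

Section density_measure.
Context (R : realType) (f : R -> R).
Hypothesis f_ge0 : forall x, 0 <= f x.
Hypothesis f_int : (@lebesgue_measure R).-integrable setT (EFin \o f).

Let mf (D : set (measurableTypeR R)) : measurable_fun D (EFin \o f).
Proof.
by apply: (@measurable_funS _ _ _ _ setT) => //; exact: measurable_int f_int.
Qed.

(** The two proofs are arguments so that the measure structures declared below can be found from the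
    term alone. *)
Definition density_measure (_ : forall x, 0 <= f x)
    (_ : (@lebesgue_measure R).-integrable setT (EFin \o f))
    (A : set (measurableTypeR R)) : \bar R :=
  (\int[lebesgue_measure]_(x in A) (f x)%:E)%E.

Local Notation nu := (density_measure f_ge0 f_int).

Let nu0 : nu set0 = 0%E.
Proof. by rewrite /density_measure integral_set0. Qed.

Let nu_ge0 A : (0 <= nu A)%E.
Proof. by rewrite /density_measure integral_ge0// => x _; rewrite lee_fin. Qed.

Let nu_sigma_additive : semi_sigma_additive nu.
Proof.
move=> /= A mA tA mUA.
rewrite /density_measure integral_bigcup//=; last first.
  exact: (integrableS _ _ (subsetT _)).
apply: is_cvg_ereal_nneg_natsum_cond => n _ _.
by apply: integral_ge0 => /= x ?; rewrite lee_fin.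
Qed.

HB.instance Definition _ := isMeasure.Build _ _ _
  nu nu0 nu_ge0 nu_sigma_additive.

Let nu_fin : fin_num_fun nu.
Proof.
move=> A mA; apply: integrable_fin_num => //.
exact: integrableS f_int.
Qed.

HB.instance Definition _ := Measure_isFinite.Build _ _ _ nu nu_fin.

Let nu_dominates : nu `<< @lebesgue_measure R.
Proof.
by apply/null_content_dominatesP => A mA muA0; exact: null_set_integral.
Qed.

(** By uniqueness [f] agrees almost everywhere with the Radon-Nikodym derivative of [nu], for which
    the formula is known. *)
Lemma integral_density_measure (G : R -> \bar R) (E : set (measurableTypeR R)) :
  measurable E -> measurable_fun E G -> (forall x, 0 <= G x)%E ->
  (\int[lebesgue_measure]_(x in E) (G x * (f x)%:E) = \int[nu]_(x in E) G x)%E.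
Proof.
move=> mE mG G0.
rewrite -(Radon_Nikodym_SigmaFinite.change_of_variables nu_dominates)//.
have mh : measurable_fun E (Radon_Nikodym_SigmaFinite.f nu (@lebesgue_measure R)).
  apply: (@measurable_funS _ _ _ _ setT) => //.
  exact: measurable_int (Radon_Nikodym_SigmaFinite.f_integrable nu_dominates).
have fE : ae_eq lebesgue_measure E (EFin \o f)
    (Radon_Nikodym_SigmaFinite.f nu (@lebesgue_measure R)).
  apply: (@integral_ae_eq _ _ _ lebesgue_measure _ mE).
  - exact: (integrableS measurableT).
  - exact: mh.
  - by move=> A AE mA; rewrite -Radon_Nikodym_SigmaFinite.f_integral.
apply: ae_eq_integral => //; first exact: emeasurable_funM.
  exact: emeasurable_funM.
exact: ae_eqe_mul2l.
Qed.

End density_measure.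

Section substitution.
Context (R : realType) (F f : R -> R) (a b : R).
Local Notation lam := (@lebesgue_measure R).
Hypothesis ab : a < b.
Hypothesis Fa : F a = 0.
Hypothesis Fb : F b = 1.
Hypothesis F_incr : {in `[a, b] &, {homo F : x y / x < y}}.
Hypothesis mF : measurable_fun (setT : set (measurableTypeR R))
  (F : measurableTypeR R -> measurableTypeR R).
Hypothesis f_ge0 : {in `[a, b], forall x, 0 <= f x}.
Hypothesis f_cont : {within `[a, b], continuous f}.
Hypothesis F_der : derivable_oo_LRcontinuous F a b.
Hypothesis F'f : {in `]a, b[, (F^`())%classic =1 f}.

Let fab := f \_ `]a, b[.

Let fab_ge0 x : 0 <= fab x.
Proof.
rewrite /fab patchE; case: ifPn => // /set_mem/= xab; apply: f_ge0.
exact: subset_itv_oo_cc.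
Qed.

Let f_integrable : lam.-integrable `[a, b] (EFin \o f).
Proof.
by apply: continuous_compact_integrable => //; exact: segment_compact.
Qed.

Let fab_integrable : lam.-integrable setT (EFin \o fab).
Proof.
rewrite (_ : EFin \o fab = (EFin \o f) \_ `]a, b[); last first.
  by rewrite /fab restrict_EFin.
apply/integrable_restrict => //=; rewrite setTI.
by apply: integrableS f_integrable => //; exact: subset_itv_oo_cc.
Qed.

Let F_cont : {within `[a, b], continuous F}.
Proof. exact: derivable_oo_LRcontinuous_within. Qed.

Local Notation nu := (density_measure fab_ge0 fab_integrable).

Let nuE E : measurable E -> nu E = (\int[lam]_(x in `]a, b[ `&` E) (f x)%:E)%E.
Proof.
move=> mE; rewrite /density_measure setIC integral_mkcondr.
by rewrite /fab restrict_EFin.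
Qed.

(** The fundamental theorem of calculus on [a, c], where F c = min y 1. Rays form a pi-system
    generating the Borel sets, so this case determines the whole pushforward. *)
Let nu_ray y : nu (F @^-1` `]-oo, y[) = lam (`]0, 1[ `&` `]-oo, y[).
Proof.
have mFy : measurable (F @^-1` `]-oo, y[) by rewrite -[X in measurable X]setTI; exact: mF.
rewrite nuE//.
have F01 x : x \in `]a, b[ -> 0 < F x < 1.
  move=> /[dup] xab /itvP xp.
  by rewrite -Fa -Fb !F_incr ?xp// in_itv/= ?lexx ltW ?xp.
have [y0|y0] := leP y 0.
  rewrite (_ : _ `&` _ = set0); last first.
    rewrite -subset0 => x [/= /F01/andP[+ _]]; rewrite in_itv/= => Fx0 xy.
    by have := lt_trans Fx0 (lt_le_trans xy y0); rewrite ltxx.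
  rewrite integral_set0 (_ : _ `&` _ = set0) ?measure0//.
  rewrite -subset0 => x [/=]; rewrite !in_itv/= => /andP[Fx0 _] xy.
  by have := lt_trans Fx0 (lt_le_trans xy y0); rewrite ltxx.
have yE : exists2 c, c \in `[a, b] & F c = Num.min y 1.
  apply: IVT => //; first exact: ltW.
  rewrite Fa Fb (min_l ler01) (max_r ler01) ge_min lexx orbT.
  by rewrite andbT le_min ltW//= ler01.
have [c cab Fc] := yE.
have ac : a < c.
  rewrite lt_neqAle (itvP cab) andbT; apply/eqP => ac.
  by move: Fc; rewrite -ac Fa => /esym/eqP; rewrite gt_eqF// lt_min y0 ltr01.
have cb : c <= b by rewrite (itvP cab).
have -> : `]a, b[ `&` F @^-1` `]-oo, y[ = `]a, c[%classic.
  apply/seteqP; split => x /=; rewrite !in_itv/=.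
    move=> [/andP[ax xb] Fxy]; rewrite ax/= ltNge; apply/negP => cx.
    have : F c <= F x.
      move: cx; rewrite le_eqVlt => /predU1P[->//|cx].
      by rewrite ltW// F_incr// in_itv/= ltW ?ltW.
    rewrite Fc leNgt lt_min Fxy/=.
    by have /andP[_ ->] := F01 x (ltac:(by rewrite in_itv/= ax)).
  move=> /andP[ax xc]; rewrite ax (lt_le_trans xc cb); split => //.
  have : F x < F c.
    by rewrite F_incr// in_itv/= !ltW// (lt_le_trans xc).
  by rewrite Fc lt_min => /andP[].
transitivity (Num.min y 1)%:E.
  have acS : `[a, c] `<=` `[a, b] by apply: subset_itvl; rewrite bnd_simp.
  rewrite -(@integral_itv_bndoo R a c (EFin \o f) true false); last first.
    apply: (@measurable_funS _ _ _ _ `[a, b]) => //.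
      by apply: subset_trans acS; exact: subset_itv_oo_cc.
    exact: measurable_int f_integrable.
  rewrite (@continuous_FTC2 R f F) ?Fa ?sube0 ?Fc//.
  - exact: continuous_subspaceW f_cont.
  - have [dF Fra Flb] := F_der; split => //.
      move=> x; rewrite in_itv/= => /andP[ax xc]; apply: dF.
      by rewrite in_itv/= ax (lt_le_trans xc).
    move: cb; rewrite le_eqVlt => /predU1P[->//|cb'].
    apply: cvg_at_left_filter.
    apply: differentiable_continuous; apply/derivable1_diffP; apply: dF.
    by rewrite in_itv/= ac.
  - move=> x; rewrite in_itv/= => /andP[ax xc]; apply: F'f.
    by rewrite in_itv/= ax (lt_le_trans xc).
have -> : `]0, 1[ `&` `]-oo, y[ = `]0, Num.min y 1[%classic.
  apply/seteqP; split => x /=; rewrite !in_itv/= lt_min.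
    by move=> [/andP[-> ->] ->].
  by move=> /and3P[-> -> ->].
by rewrite lebesgue_measure_itv/= lte_fin lt_min y0 ltr01 sube0.
Qed.

Let pushforwardE (E : set (measurableTypeR R)) : measurable E ->
  pushforward nu F E = lam (`]0, 1[ `&` E).
Proof.
move=> mE.
have -> : lam (`]0, 1[ `&` E) = mrestr lam (measurable_itv `]0%R, 1%R[) E.
  by rewrite /mrestr setIC.
pose F' : measurableTypeR R -> measurableTypeR R := F.
pose m1 :
  {measure set (measurableTypeR R) -> \bar R} := pushforward nu F'.
pose m2 : {measure set (measurableTypeR R) -> \bar R} :=
  mrestr lam (measurable_itv `]0%R, 1%R[).
rewrite -[LHS]/(m1 mF E) -[RHS]/(m2 E).
refine (@measure_unique _ R (measurableTypeR R) (@RGenInftyO.G R)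
  (fun n => `]-oo, n%:R[%classic) _ _ _ _ (m1 mF) m2 _ _ E mE) => //.
- exact: RGenInftyO.measurableE.
- move=> A B [x ->] [y ->]; exists (Num.min x y).
  by apply/seteqP; split => z /=; rewrite !in_itv/= lt_min => /andP.
- by move=> n; exists n%:R.
- rewrite -subTset => x _; exists (Num.truncn `|x|).+1 => //=.
  rewrite in_itv/=; apply: le_lt_trans (ler_norm x) _.
  exact: truncnS_gt.
- by move=> _ [y ->]; rewrite /m2/= /mrestr setIC -nu_ray.
- move=> k; rewrite ltey_eq; apply/orP; left; rewrite /m1/= /pushforward.
  apply: fin_num_measure.
  by rewrite -[X in _ X]setTI; exact: mF.
Qed.

(** Both sides integrate [G] against the same measure, since [F] pushes the measure f dx on ]a,
    b[ forward to Lebesgue measure on ]0, 1[. *)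
Lemma integral_substitution (G : R -> \bar R) (E : set (measurableTypeR R)) :
  measurable E -> measurable_fun (setT : set (measurableTypeR R)) G ->
  (forall x, 0 <= G x)%E ->
  (\int[lam]_(x in (`]0%R, 1%R[ `&` E)%classic) G x =
   \int[lam]_(x in (`]a, b[ `&` F @^-1` E)%classic) (G (F x) * (f x)%:E))%E.
Proof.
move=> mE mG G0.
have mGF : measurable_fun (setT : set (measurableTypeR R)) (G \o F) by exact: measurableT_comp.
have mFE : measurable (F @^-1` E).
  by rewrite -[X in measurable X]setTI; exact: mF.
pose F' : measurableTypeR R -> measurableTypeR R := F.
pose m1 : {measure set (measurableTypeR R) -> \bar R} := pushforward nu F'.
transitivity (\int[m1 mF]_(x in E) G x)%E; last first.
  rewrite [LHS](ge0_integral_pushforward mF)//; last first.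
    exact: measurable_funS mG.
  rewrite -integral_density_measure//=; last exact: measurable_funS mGF.
  rewrite [in RHS]setIC integral_mkcondr; apply: eq_integral => x _.
  by rewrite /fab !patchE; case: ifPn => // _; rewrite mule0.
pose i01 : R -> R := \1_(`]0, 1[%classic).
have i01_ge0 x : 0 <= i01 x by rewrite /i01 indicE.
have i01_int : lam.-integrable setT (EFin \o i01).
  by apply: integrable_indic_itv.
transitivity (\int[density_measure i01_ge0 i01_int]_(x in E) G x)%E; last first.
  apply: eq_measure_integral.
  move=> A mA _; rewrite /m1/=.
  rewrite [RHS]pushforwardE// [LHS]integral_indic//.
rewrite -integral_density_measure//; last exact: measurable_funS mG.
rewrite setIC integral_mkcondr; apply: eq_integral => x _.
by rewrite /i01 indicE patchE; case: ifPn => _; rewrite ?mule1 ?mule0.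
Qed.

End substitution.
(** * The left branch *)

Section left_branch.
Context (R : realType) (alpha : R).
Hypothesis alpha01 : 0 < alpha < 1.

Let alpha_gt0 : 0 < alpha. Proof. by case/andP: alpha01. Qed.
Let alpha_ge0 : 0 <= alpha. Proof. exact: ltW. Qed.

Definition lpow (y : R) : R := 2 `^ alpha * y `^ alpha.
Definition lbranch (y : R) : R := y * (1 + lpow y).
(** The derivative of [lbranch]. *)
Definition lslope (y : R) : R := 1 + (1 + alpha) * lpow y.

Lemma lpow_ge0 y : 0 <= lpow y.
Proof. by rewrite mulr_ge0 ?powR_ge0. Qed.

Lemma lpow_le x y : 0 <= x -> x <= y -> lpow x <= lpow y.
Proof.
move=> x0 xy; rewrite ler_wpM2l ?powR_ge0// ge0_ler_powR// nnegrE//.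
exact: le_trans xy.
Qed.

Lemma lpow0 : lpow 0 = 0.
Proof. by rewrite /lpow powR0 ?mulr0// gt_eqF. Qed.

Lemma lpow_half : lpow (1 / 2) = 1.
Proof. by rewrite /lpow -powRM ?divr_ge0// mulrC divfK// powR1. Qed.

Lemma lpow_le1 y : 0 <= y -> y <= 1 / 2 -> lpow y <= 1.
Proof. by move=> y0 y2; rewrite -lpow_half lpow_le. Qed.

Lemma lbranch0 : lbranch 0 = 0.
Proof. by rewrite /lbranch mul0r. Qed.

Lemma lbranch_half : lbranch (1 / 2) = 1.
Proof. by rewrite /lbranch lpow_half; lra. Qed.

Lemma lbranch_lt x y : 0 <= x -> x < y -> lbranch x < lbranch y.
Proof.
move=> x0 xy; rewrite /lbranch; have := lpow_le x0 (ltW xy).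
have := lpow_ge0 x; have := lpow_ge0 y => *.
apply: (@le_lt_trans _ _ (x * (1 + lpow y))).
  by rewrite ler_wpM2l// lerD2l.
by rewrite ltr_pM2r// ltr_pwDl.
Qed.

Lemma lbranch_le x y : 0 <= x -> x <= y -> lbranch x <= lbranch y.
Proof.
by move=> x0; rewrite le_eqVlt => /predU1P[->//|/(lbranch_lt x0)/ltW].
Qed.

Lemma lslope_ge1 y : 1 <= lslope y.
Proof.
by rewrite /lslope lerDl mulr_ge0 ?lpow_ge0// addr_ge0.
Qed.

Lemma lsv_left y : y < 1 / 2 -> lsv alpha y = lbranch y.
Proof. by rewrite /lsv => ->. Qed.

Lemma lsv_right y : 1 / 2 <= y -> lsv alpha y = 2 * y - 1.
Proof. by rewrite /lsv ltNge => ->. Qed.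

Lemma is_derive_lbranch (y : R) : 0 < y -> is_derive y 1 lbranch (lslope y).
Proof.
move=> y0.
have dp : is_derive y (1 : R) (fun z => z `^ alpha) (alpha * y `^ (alpha - 1)).
  exact: is_derive1_powR.
have dl : is_derive y (1 : R) lpow (2 `^ alpha * (alpha * y `^ (alpha - 1))).
  exact: is_deriveZ.
rewrite (_ : lbranch = id * (cst 1 + lpow))//.
apply: is_derive_eq.
rewrite /GRing.scale/= fctE/= /lslope /lpow -(mulr_powRB1 (ltW y0) alpha_gt0).
by ring.
Qed.

Lemma cvg_lpow0 : lpow x @[x --> 0^'+] --> lpow 0.
Proof.
rewrite lpow0 -[X in _ --> X](mulr0 (2 `^ alpha)); apply: cvgM; first exact: cvg_cst.
exact: powR_cvg0.
Qed.

Lemma continuous_lpow y : 0 < y -> {for y, continuous lpow}.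
Proof.
move=> y0; apply: continuousM; first exact: cst_continuous.
apply: differentiable_continuous; apply/derivable1_diffP.
by have [] := is_derive1_powR alpha y0.
Qed.

Lemma derivable_lbranch : derivable_oo_LRcontinuous lbranch 0 (1 / 2).
Proof.
split.
- by move=> y /[!in_itv]/= /andP[y0 _]; have [] := is_derive_lbranch y0.
- rewrite -[X in _ --> X]/(0 * (1 + lpow 0)); apply: cvgM.
    by apply: cvg_at_right_filter; exact: cvg_id.
  by apply: cvgD; [exact: cvg_cst|exact: cvg_lpow0].
- apply: cvg_at_left_filter; apply: differentiable_continuous.
  by apply/derivable1_diffP; have [] := @is_derive_lbranch (1 / 2) ltac:(lra).
Qed.

Lemma continuous_lslope : {within `[0, 1 / 2], continuous lslope}.
Proof.
apply/continuous_within_itvP; first by lra.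
split.
- move=> y /[!in_itv]/= /andP[y0 _]; apply: cvgD; first exact: cvg_cst.
  by apply: cvgM; [exact: cvg_cst|exact: continuous_lpow].
- apply: cvgD; first exact: cvg_cst.
  by apply: cvgM; [exact: cvg_cst|exact: cvg_lpow0].
- apply: cvg_at_left_filter; apply: cvgD; first exact: cvg_cst.
  by apply: cvgM; [exact: cvg_cst|apply: continuous_lpow; lra].
Qed.

Lemma lbranch_surj x : 0 < x -> x < 1 ->
  exists2 y, 0 < y < 1 / 2 & lbranch y = x.
Proof.
move=> x0 x1.
have [y y02 yx] : exists2 y, y \in `[0, 1 / 2] & lbranch y = x.
  apply: IVT; first by lra.
    exact: derivable_oo_LRcontinuous_within derivable_lbranch.
  by rewrite lbranch0 lbranch_half (min_l ler01) (max_r ler01) !ltW.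
move: y02; rewrite in_itv/= !le_eqVlt => /andP[/predU1P[y0|y0] y2].
  by move: yx x0; rewrite -y0 lbranch0 => <-; rewrite ltxx.
case/predU1P: y2 => [y2|y2].
  by move: yx x1; rewrite y2 lbranch_half => <-; rewrite ltxx.
by exists y => //; rewrite y0.
Qed.

(* Extended by constants outside ]0, 1[ so as to be monotone on the whole line,
   hence measurable. *)
Definition linv (x : R) : R :=
  if x <= 0 then 0 else if 1 <= x then 1 / 2 else
  xget 0 [set y | 0 < y < 1 / 2 /\ lbranch y = x].

Lemma linv_itv x : 0 < x -> x < 1 -> 0 < linv x < 1 / 2.
Proof.
move=> x0 x1; rewrite /linv !leNgt x0 x1/=.
by have [y y02 yx] := lbranch_surj x0 x1; case: xgetP => [z _ []|/(_ y)[]].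
Qed.

Lemma linv1 : linv 1 = 1 / 2.
Proof. by rewrite /linv ler10 lexx. Qed.

Lemma linvK x : 0 < x -> x <= 1 -> lbranch (linv x) = x.
Proof.
move=> x0; rewrite le_eqVlt => /predU1P[->|x1]; first by rewrite linv1 lbranch_half.
rewrite /linv !leNgt x0 x1/=.
by have [y y02 yx] := lbranch_surj x0 x1; case: xgetP => [z _ []|/(_ y)[]].
Qed.

Lemma lbranch_inj x y : 0 <= x -> 0 <= y -> lbranch x = lbranch y -> x = y.
Proof.
move=> x0 y0 xy; case: (ltgtP x y) => // [/(lbranch_lt x0)|/(lbranch_lt y0)];
  by rewrite xy ltxx.
Qed.

Lemma linv_gt0 x : 0 < x -> 0 < linv x.
Proof.
move=> x0; have [x1|x1] := ltP x 1; first by case/andP: (linv_itv x0 x1).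
by rewrite /linv leNgt x0 x1.
Qed.

Lemma linv_ge0 x : 0 <= linv x.
Proof.
by have [x0|/linv_gt0/ltW//] := leP x 0; rewrite /linv x0.
Qed.

Lemma linv_le_half x : linv x <= 1 / 2.
Proof.
rewrite /linv; case: ifPn => [_|]; first by lra.
rewrite -ltNge => x0; case: ifPn => //; rewrite -ltNge => x1.
have [y y02 yx] := lbranch_surj x0 x1; case: xgetP => [z _ []|/(_ y)[]//].
by move=> /andP[_ /ltW].
Qed.

Lemma lbranchK y : 0 < y -> y <= 1 / 2 -> linv (lbranch y) = y.
Proof.
move=> y0 y2; have fy0 : 0 < lbranch y by rewrite -lbranch0 lbranch_lt.
apply: lbranch_inj; [exact/ltW/linv_gt0|exact: ltW|].
by rewrite linvK// -lbranch_half lbranch_le// ltW.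
Qed.

Lemma linv_le_iff x y : 0 < x -> x <= 1 -> 0 <= y -> (linv x <= y) = (x <= lbranch y).
Proof.
move=> x0 x1 y0; rewrite -[in RHS](linvK x0 x1); apply/idP/idP.
  by apply: lbranch_le; exact/ltW/linv_gt0.
by apply: contraTT; rewrite -!ltNge; exact: lbranch_lt.
Qed.

Lemma linv_lt_iff x y : 0 < x -> x <= 1 -> 0 <= y -> (y < linv x) = (lbranch y < x).
Proof. by move=> *; rewrite !ltNge linv_le_iff. Qed.

Lemma linv_nondecreasing : {homo linv : x y / x <= y}.
Proof.
move=> x y xy; have [x0|x0] := leP x 0; first by rewrite {1}/linv x0 linv_ge0.
have y0 := lt_le_trans x0 xy; have [y1|y1] := leP 1 y.
  have -> : linv y = 1 / 2 by rewrite /linv y1 leNgt y0.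
  exact: linv_le_half.
by rewrite linv_le_iff ?linv_ge0// ?linvK ?(ltW y1)// (le_trans xy)// ltW.
Qed.

Lemma lpow_gt0 y : 0 < y -> 0 < lpow y.
Proof. by move=> y0; rewrite mulr_gt0 ?powR_gt0. Qed.

Lemma linv_lt x : 0 < x -> x <= 1 -> linv x < x.
Proof.
move=> x0 x1; rewrite -[ltRHS](linvK x0 x1) /lbranch mulrDr mulr1 ltrDl.
by rewrite mulr_gt0 ?linv_gt0// lpow_gt0// linv_gt0.
Qed.

Lemma measurable_lpow : measurable_fun (setT : set (measurableTypeR R)) lpow.
Proof.
by apply: measurable_funM; [exact: measurable_cst|exact: measurable_powR].
Qed.

Lemma measurable_lbranch :
  measurable_fun (setT : set (measurableTypeR R)) lbranch.
Proof.
apply: measurable_funM; first exact: measurable_id.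
by apply: measurable_funD; [exact: measurable_cst|exact: measurable_lpow].
Qed.

Lemma measurable_lslope :
  measurable_fun (setT : set (measurableTypeR R)) lslope.
Proof.
apply: measurable_funD; first exact: measurable_cst.
by apply: measurable_funM; [exact: measurable_cst|exact: measurable_lpow].
Qed.

Lemma measurable_linv : measurable_fun (setT : set (measurableTypeR R)) linv.
Proof. exact: nondecreasing_measurable linv_nondecreasing. Qed.

Lemma measurable_lsv :
  measurable_fun (setT : set (measurableTypeR R)) (lsv alpha).
Proof.
apply: measurable_fun_ifT.
- exact: measurable_fun_ltr.
- exact: measurable_lbranch.
- apply: measurable_funB; last exact: measurable_cst.
  by apply: measurable_funM; [exact: measurable_cst|exact: measurable_id].
Qed.

End left_branch.
(** * Transfer operators and regular densities *)

Section mass.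
Context (R : realType).
Local Notation lam := (@lebesgue_measure R).
Local Notation T := (measurableTypeR R).
Implicit Types (g : R -> R) (E B : set T).

Definition density g : Prop :=
  [/\ measurable_fun (setT : set T) (g : T -> T),
      lam.-integrable (`]0, 1[%classic : set T) (EFin \o g)
    & forall x, 0 < x -> x < 1 -> 0 <= g x].

(** Only the open interval counts: both inverse branches map it into itself, and regularity speaks
    of ln x there. *)
Definition mass g E : R := \int[lam]_(x in E `&` `]0, 1[) g x.

Let mI : measurable (`]0, 1[%classic : set T). Proof. by []. Qed.
Local Hint Resolve mI : core.

Let densityI g E : density g -> measurable E ->
  lam.-integrable (E `&` `]0, 1[) (EFin \o g).
Proof.
by move=> [_ gi _] mE; apply: integrableS gi => //; exact: measurableI.
Qed.

Lemma eq_mass_set g E B : E `&` `]0, 1[ = B `&` `]0, 1[ -> mass g E = mass g B.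
Proof. by rewrite /mass => ->. Qed.

Lemma eq_mass g1 g2 E : (forall x, E x -> 0 < x -> x < 1 -> g1 x = g2 x) ->
  mass g1 E = mass g2 E.
Proof.
move=> g12; apply: eq_Rintegral => x /set_mem[Ex /=].
by rewrite in_itv/= => /andP[x0 x1]; exact: g12.
Qed.

Lemma mass_ge0 g E : density g -> 0 <= mass g E.
Proof.
move=> [_ _ g0]; apply: Rintegral_ge0 => x [_ /=].
by rewrite in_itv/= => /andP[x0 x1]; exact: g0.
Qed.

Lemma massID g E B : density g -> measurable E -> measurable B ->
  mass g E = mass g (E `&` B) + mass g (E `&` ~` B).
Proof.
move=> dg mE mB; rewrite /mass -Rintegral_setU//.
- by rewrite -setIUl -setIUr setUv setIT.
- by apply: measurableI => //; exact: measurableI.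
- by apply: measurableI => //; apply: measurableI => //; exact: measurableC.
- by rewrite -setIUl -setIUr setUv setIT; exact: densityI.
- apply/disj_setPS => x [[[_ Bx] _] [[_ nBx] _]]; exact: nBx.
Qed.

Lemma mass_setU g E B : density g -> measurable E -> measurable B ->
  E `&` B = set0 -> mass g (E `|` B) = mass g E + mass g B.
Proof.
move=> dg mE mB EB0; rewrite (@massID _ (E `|` B) E)//; last exact: measurableU.
congr (mass g _ + mass g _).
- by rewrite setUC setIC setKU.
- rewrite setIUl setICr set0U; apply/seteqP; split => [x []//|x Bx].
  by split => // Ex; have : (E `&` B) x by []; rewrite EB0.
Qed.

Lemma le_mass_set g E B : density g -> measurable E -> measurable B ->
  E `<=` B -> mass g E <= mass g B.
Proof.
move=> dg mE mB EB; rewrite (@massID _ B E)// (setIidr EB) lerDl.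
exact: mass_ge0.
Qed.

Lemma massD g1 g2 E : density g1 -> density g2 -> measurable E ->
  mass (fun x => g1 x + g2 x) E = mass g1 E + mass g2 E.
Proof. by move=> d1 d2 mE; apply: RintegralD; [exact: measurableI|exact: densityI..]. Qed.

Lemma massZ c g E : density g -> measurable E ->
  mass (fun x => c * g x) E = c * mass g E.
Proof. by move=> d1 mE; apply: RintegralZl; [exact: measurableI|exact: densityI]. Qed.

Lemma le_mass g1 g2 E : density g1 -> density g2 -> measurable E ->
  (forall x, E x -> 0 < x -> x < 1 -> g1 x <= g2 x) -> mass g1 E <= mass g2 E.
Proof.
move=> d1 d2 mE g12; apply: le_Rintegral;
  [exact: measurableI|exact: densityI|exact: densityI|].
by move=> x [Ex /=]; rewrite in_itv/= => /andP[x0 x1]; exact: g12.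
Qed.

Lemma density_cst c : 0 <= c -> density (fun=> c).
Proof.
move=> c0; split => //.
apply: measurable_bounded_integrable => //.
- by rewrite [X in (X < _)%E]lebesgue_measure_itv/= lte_fin ltr01 -EFinB ltry.
- by exists `|c|; split => // x xc y _; exact: ltW.
Qed.

Lemma densityD g1 g2 : density g1 -> density g2 -> density (fun x => g1 x + g2 x).
Proof.
move=> [m1 i1 p1] [m2 i2 p2]; split; first exact: measurable_funD.
- exact: (integrableD mI i1 i2).
- by move=> x x0 x1; rewrite addr_ge0 ?p1 ?p2.
Qed.

Lemma density_le g1 g2 : density g2 ->
  measurable_fun (setT : set T) (g1 : T -> T) ->
  (forall x, 0 < x -> x < 1 -> 0 <= g1 x <= g2 x) -> density g1.
Proof.
move=> [m2 i2 p2] m1 g12; split => //; last first.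
  by move=> x x0 x1; case/andP: (g12 x x0 x1).
apply: le_integrable i2 => //.
  by apply/measurable_EFinP; exact: measurable_funTS.
move=> x /=; rewrite in_itv/= => /andP[x0 x1]; rewrite lee_fin.
by case/andP: (g12 x x0 x1) => h1 h2; rewrite !ger0_norm// p2.
Qed.

Lemma mass_cst c E : measurable E -> mass (fun=> c) E = c * mass (fun=> 1) E.
Proof.
move=> mE; rewrite -massZ//; last exact: density_cst.
by apply: eq_mass => x; rewrite mulr1.
Qed.

Lemma mass_le_cst c g E : density g -> 0 <= c -> measurable E ->
  (forall x, E x -> 0 < x -> x < 1 -> g x <= c) -> mass g E <= c * mass (fun=> 1) E.
Proof. by move=> dg c0 mE gc; rewrite -mass_cst// le_mass//; exact: density_cst. Qed.

Lemma mass_ge_cst c g E : density g -> 0 <= c -> measurable E ->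
  (forall x, E x -> 0 < x -> x < 1 -> c <= g x) -> c * mass (fun=> 1) E <= mass g E.
Proof. by move=> dg c0 mE gc; rewrite -mass_cst// le_mass//; exact: density_cst. Qed.

Lemma mass1_itv (a b : R) b0 b1 : 0 <= a -> a <= b -> b <= 1 ->
  mass (fun=> 1) [set` Interval (BSide b0 a) (BSide b1 b)] = b - a.
Proof.
move=> a0 ab b1'; rewrite /mass Rintegral_cst; last exact: measurableI.
rewrite mul1r.
suff /(congr1 fine) : lam ([set` Interval (BSide b0 a) (BSide b1 b)] `&` `]0, 1[)
    = (b - a)%:E by [].
have lamab c d : lam [set` Interval (BSide c a) (BSide d b)] = (b - a)%:E.
  rewrite [LHS]lebesgue_measure_itv/= lte_fin.
  by move: ab; rewrite le_eqVlt => /predU1P[->|->]; rewrite ?ltxx ?subrr.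
  apply/eqP; rewrite eq_le; apply/andP; split.
    rewrite -(lamab true false); apply: le_measure; rewrite ?inE//.
      exact: measurableI.
    move=> x [/= xab _]; by apply: (subset_itv_bound _ _ xab) => //; case: (b0).
  rewrite -(lamab false true); apply: le_measure; rewrite ?inE//.
    exact: measurableI.
  move=> x /= xab; split => /=; first by apply: (subset_itv_bound _ _ xab) => //; case: (b1).
  rewrite in_itv/=; move: xab; rewrite in_itv/= => /andP[ax xb].
  by rewrite (le_lt_trans a0 ax) (lt_le_trans xb b1').
Qed.

Lemma mass_null g E B : density g -> measurable E -> measurable B ->
  E `<=` B -> mass g (B `\` E) = 0 -> mass g E = mass g B.
Proof.
by move=> dg mE mB EB BE0; rewrite (@massID _ B E)// (setIidr EB) -setDE BE0 addr0.
Qed.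

Lemma mass_set1 g r : mass g [set r] = 0.
Proof.
rewrite /mass; have [r01|r01] := boolP (r \in `]0, 1[).
  rewrite (_ : _ `&` _ = [set r]) ?Rintegral_set1//.
  by apply/seteqP; split => [x []//|x /= ->].
rewrite (_ : _ `&` _ = set0) ?Rintegral_set0//.
by rewrite -subset0 => x [/= ->]; apply/negP.
Qed.

End mass.
Section transfer.
Context (R : realType).
Local Notation lam := (@lebesgue_measure R).
Local Notation T := (measurableTypeR R).

(** The contribution of one full branch [F], with derivative [f] and inverse [psi], to the transfer
    operator; it is used once for each branch of the map. *)
Lemma mass_substitution (F f psi : R -> R) (a b : R) (g : R -> R) :
  a < b -> 0 <= a -> b <= 1 -> F a = 0 -> F b = 1 ->
  {in `[a, b] &, {homo F : x y / x < y}} ->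
  measurable_fun (setT : set T) (F : T -> T) ->
  measurable_fun (setT : set T) (f : T -> T) ->
  measurable_fun (setT : set T) (psi : T -> T) ->
  (forall x, 0 < f x) ->
  {within `[a, b], continuous f} ->
  derivable_oo_LRcontinuous F a b ->
  {in `]a, b[, (F^`())%classic =1 f} ->
  (forall x, 0 < x -> x < 1 -> a < psi x < b) ->
  (forall y, a < y -> y < b -> psi (F y) = y) ->
  density g ->
  density (fun x => g (psi x) / f (psi x)) /\
  forall E : set T, measurable E ->
    mass (fun x => g (psi x) / f (psi x)) E = mass g (`]a, b[ `&` F @^-1` E).
Proof.
move=> ab a0 b1 Fa Fb Fincr mF mf mpsi f0 cf dF F'f psiab psiF [mg gi g0].
pose G x := g (psi x) / f (psi x).
have G0 x : 0 < x -> x < 1 -> 0 <= G x.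
  move=> x0 x1; have /andP[pa pb] := psiab x x0 x1.
  apply: divr_ge0; last exact: ltW.
  by apply: g0; [exact: le_lt_trans pa|exact: lt_le_trans b1].
have mG : measurable_fun (setT : set T) (G : T -> T).
  apply: measurable_funM; first exact: measurableT_comp.
  have -> : (fun x => (f (psi x))^-1) = (fun x => (f (psi x)) `^ (-1)).
    by apply/funext => x; rewrite powR_inv1// ltW.
  apply: (@measurableT_comp _ _ _ T T T (fun z : T => z `^ (-1) : T)).
    exact: measurable_powR.
  exact: measurableT_comp.
have Gint (E : set T) : measurable E ->
  (\int[lam]_(x in (E `&` `]0%R, 1%R[)%classic) (G x)%:E =
  \int[lam]_(x in ((`]a, b[ `&` F @^-1` E) `&` `]0%R, 1%R[)%classic) (g x)%:E)%E.
  move=> mE.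
  pose G01 := (EFin \o G) \_ `]0, 1[.
  have mG01 : measurable_fun (setT : set T) G01.
    apply/(measurable_restrictT _ _).1 => //.
    by apply/measurable_EFinP; exact: measurable_funS mG.
  have G01_ge0 x : (0 <= G01 x)%E.
    rewrite /G01 patchE; case: ifPn => // /set_mem/=.
    by rewrite in_itv/= lee_fin => /andP[x0 x1]; exact: G0.
  transitivity (\int[lam]_(x in (`]0%R, 1%R[ `&` E)%classic) G01 x)%E.
    rewrite setIC; apply: eq_integral => x /set_mem[x01 _].
    by rewrite /G01 patchE mem_set.
  rewrite (integral_substitution ab Fa Fb Fincr mF _ cf dF F'f mE mG01 G01_ge0); last first.
    by move=> x _; exact/ltW.
  rewrite (@setIidl _ (_ `&` _) `]0, 1[); last first.
    move=> x [/= + _]; rewrite !in_itv/= => /andP[ax xb].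
    by rewrite (le_lt_trans a0 ax) (lt_le_trans xb b1).
  apply: eq_integral => x /set_mem[/= + _]; rewrite in_itv/= => /andP[ax xb].
  have Fx01 : 0 < F x < 1.
    by rewrite -Fa -Fb !Fincr// in_itv/= ?lexx !ltW.
  rewrite /G01 patchE mem_set//= -EFinM /G psiF// divfK//.
  by rewrite gt_eqF.
have mFE (E : set T) : measurable E -> measurable (`]a, b[ `&` F @^-1` E : set T).
  move=> mE; apply: measurableI => //.
  by rewrite -[X in measurable X]setTI; exact: mF.
split; last first.
  by move=> E mE; rewrite /mass /Rintegral Gint.
split => //.
have mG' : measurable_fun (`]0%R, 1%R[%classic : set T) (EFin \o G).
  by apply/measurable_EFinP; exact: measurable_funS mG.
apply/integrableP; split => //.
have := Gint setT measurableT; rewrite setTI => Gi.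
under eq_integral.
  move=> x /set_mem/=; rewrite in_itv/= => /andP[x0 x1].
  rewrite ger0_norm ?G0//.
  over.
rewrite /= Gi; have := mFE setT measurableT => mab.
have : lam.-integrable ((`]a, b[ `&` F @^-1` setT) `&` `]0, 1[) (EFin \o g).
  by apply: integrableS gi => //; exact: measurableI.
move=> /(integrable_fin_num _) h; rewrite ltey_eq h//.
exact: measurableI.
Qed.

(* The contributions of the left and the right branch to the transfer operator
   of lsv alpha. *)
Definition Tl alpha (g : R -> R) (x : R) : R :=
  g (linv alpha x) / lslope alpha (linv alpha x).

Definition Tr (g : R -> R) (x : R) : R := g ((1 + x) / 2) / 2.

Definition lefth : set T := `]-oo, 1 / 2[%classic.
Definition righth : set T := `[1 / 2, +oo[%classic.

Lemma measurable_lefth : measurable lefth. Proof. exact: measurable_itv. Qed.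
Lemma measurable_righth : measurable righth. Proof. exact: measurable_itv. Qed.

Lemma setC_lefth : ~` lefth = righth.
Proof. by rewrite /lefth /righth setCitvl. Qed.

Section left_transfer.
Context (alpha : R).
Hypothesis alpha01 : 0 < alpha < 1.

Let Tl_substitution (g : R -> R) : density g ->
  density (Tl alpha g) /\ forall E : set T, measurable E ->
    mass (Tl alpha g) E = mass g (`]0, 1 / 2[ `&` lbranch alpha @^-1` E).
Proof.
have := alpha01 => /andP[a0 a1].
move=> dg; apply: (mass_substitution (F := lbranch alpha)) => //; try by lra.
- exact: lbranch0.
- exact: lbranch_half.
- move=> x y; rewrite !in_itv/= => /andP[x0 _] _; exact: lbranch_lt.
- exact: measurable_lbranch.
- exact: measurable_lslope.
- exact: measurable_linv.
- by move=> x; apply: lt_le_trans (lslope_ge1 alpha01 x).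
- exact: continuous_lslope.
- exact: derivable_lbranch.
- move=> x; rewrite in_itv/= => /andP[x0 _]; rewrite derive1E.
  by have [_ ->] := is_derive_lbranch alpha01 x0.
- exact: linv_itv.
- by move=> y y0 y2; rewrite lbranchK// ltW.
Qed.

Lemma density_Tl g : density g -> density (Tl alpha g).
Proof. by case/Tl_substitution. Qed.

Lemma mass_Tl g (E : set T) : density g -> measurable E ->
  mass (Tl alpha g) E = mass g (lefth `&` lsv alpha @^-1` E).
Proof.
move=> dg mE; have [_ ->//] := Tl_substitution dg.
apply: eq_mass_set; apply/seteqP; split => x [[/=]]; rewrite !in_itv/=.
  by move=> /andP[x0 x2] Ex x01; rewrite lsv_left.
by move=> x2; rewrite lsv_left// => Ex /andP[x0 x1]; rewrite x0 x1.
Qed.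

Let Tr_substitution (g : R -> R) : density g ->
  density (Tr g) /\ forall E : set T, measurable E ->
    mass (Tr g) E = mass g (`]1 / 2, 1[ `&` (fun x => 2 * x - 1) @^-1` E).
Proof.
have m2 : measurable_fun (setT : set T) ((fun x => 2 * x - 1) : T -> T).
  apply: measurable_funB; last exact: measurable_cst.
  by apply: measurable_funM; [exact: measurable_cst|exact: measurable_id].
have d2 (x : R) : is_derive x (1 : R) (fun x : R => 2 * x - 1) 2.
  rewrite (_ : (fun x : R => 2 * x - 1) = (cst 2 * id - cst 1))//.
  apply: is_derive_eq.
  by rewrite /GRing.scale/= /cst; ring.
have c2 : continuous (fun x : R => 2 * x - 1).
  move=> x; apply: differentiable_continuous; apply/derivable1_diffP.
  by have [] := d2 x.
move=> dg; apply: (mass_substitution (F := fun x => 2 * x - 1) (f := cst 2)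
    (psi := fun x => (1 + x) / 2)) => //; try by lra.
- by move=> x y _ _ xy; lra.
- apply: measurable_funM; last exact: measurable_cst.
  by apply: measurable_funD; [exact: measurable_cst|exact: measurable_id].
- by apply: continuous_subspaceT => x; exact: cst_continuous.
- split.
  + by move=> x _; have [] := d2 x.
  + by apply: cvg_at_right_filter; exact: c2.
  + by apply: cvg_at_left_filter; exact: c2.
- by move=> x _; rewrite derive1E; have [_ ->] := d2 x.
- by move=> x x0 x1; apply/andP; split; lra.
- by move=> y _ _; field.
Qed.

Lemma density_Tr g : density g -> density (Tr g).
Proof. by case/Tr_substitution. Qed.

Lemma measurable_lsv_preimage (E : set T) :
  measurable E -> measurable (lsv alpha @^-1` E : set T).
Proof.
by move=> mE; rewrite -[X in measurable X]setTI; exact: (measurable_lsv alpha).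
Qed.

Lemma mass_Tr g (E : set T) : density g -> measurable E ->
  mass (Tr g) E = mass g (righth `&` lsv alpha @^-1` E).
Proof.
move=> dg mE; have [_ ->//] := Tr_substitution dg.
have m2 : measurable_fun (setT : set T) ((fun x => 2 * x - 1) : T -> T).
  apply: measurable_funB; last exact: measurable_cst.
  by apply: measurable_funM; [exact: measurable_cst|exact: measurable_id].
have mA : measurable (`]1 / 2, 1[ `&` (fun x : T => 2 * x - 1 : T) @^-1` E).
  apply: measurableI => //.
  by rewrite -[X in measurable X]setTI; exact: m2.
have mB : measurable (righth `&` lsv alpha @^-1` E `&` `]-oo, 1[).
  apply: measurableI => //; apply: measurableI; first exact: measurable_righth.
  exact: measurable_lsv_preimage.
(* The substitution is over ]1/2, 1[ whereas [righth] contains 1/2; the two sets differ by at most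
   this null point. *)
transitivity (mass g (righth `&` lsv alpha @^-1` E `&` `]-oo, 1[)).
  apply: mass_null => //.
    move=> x [/=]; rewrite in_itv/= => /andP[x2 x1] Ex.
    split; last by rewrite /= in_itv.
    by split; rewrite /righth/= ?in_itv/= ?lsv_right ?ltW.
  apply/eqP; rewrite eq_le; apply/andP; split; last exact: mass_ge0.
  rewrite -(mass_set1 g (1 / 2)); apply: le_mass_set => //.
    exact: measurableD.
  move=> x [[[/= + +] +]]; rewrite /righth/= !in_itv/= andbT => x2.
  rewrite lsv_right// => Ex x1 nx; apply/eqP; rewrite eq_le x2 andbT leNgt.
  apply/negP => x2'; apply: nx; split => //=.
  by rewrite ?in_itv/= ?x2' ?x1.
apply: eq_mass_set; apply/seteqP; split => x; first by move=> [[]].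
by move=> [? /= /[dup] ?]; rewrite !in_itv/= => /andP[? ?]; split => //; split.
Qed.

Lemma mass_lsv_preimage g (E : set T) : density g -> measurable E ->
  mass g (lsv alpha @^-1` E) = mass (fun x => Tl alpha g x + Tr g x) E.
Proof.
move=> dg mE; rewrite massD//; [|exact: density_Tl|exact: density_Tr].
rewrite mass_Tl// mass_Tr// (massID dg (measurable_lsv_preimage mE) measurable_lefth).
by rewrite setC_lefth !(setIC (lsv alpha @^-1` E)).
Qed.

End left_transfer.

(* For positive g this says that ln (g x) is K-Lipschitz as a function of
   ln x. *)
Definition regular (K : nat) (g : R -> R) : Prop := density g /\
  forall x y, 0 < x -> x <= y -> y < 1 ->
    x ^+ K * g x <= y ^+ K * g y /\ x ^+ K * g y <= y ^+ K * g x.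

Lemma regular_density K g : regular K g -> density g.
Proof. by case. Qed.

Lemma regular_ge0 K g x : regular K g -> 0 < x -> x < 1 -> 0 <= g x.
Proof. by case=> -[_ _ +] _; exact. Qed.

Lemma regularW K K' g : (K <= K')%N -> regular K g -> regular K' g.
Proof.
move=> KK' [dg rg]; split => // x y x0 xy y1; have [r1 r2] := rg x y x0 xy y1.
have y0 := lt_le_trans x0 xy; have x1 := le_lt_trans xy y1.
have [_ _ g0] := dg.
have xyd : x ^+ (K' - K) <= y ^+ (K' - K).
  by rewrite lerXn2r// nnegrE ltW.
rewrite -(subnK KK') !exprD -!mulrA; split; apply: ler_pM => //;
  by rewrite ?mulr_ge0 ?exprn_ge0 ?g0 ?(ltW x0).
Qed.

Lemma regularD K g1 g2 : regular K g1 -> regular K g2 ->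
  regular K (fun x => g1 x + g2 x).
Proof.
move=> [d1 r1] [d2 r2]; split; first exact: densityD.
move=> x y x0 xy y1; have [? ?] := r1 x y x0 xy y1.
by have [? ?] := r2 x y x0 xy y1; rewrite !mulrDr !lerD.
Qed.

Lemma regular_cst c : 0 <= c -> regular 0 (fun=> c).
Proof. by move=> c0; split; [exact: density_cst|move=> *; rewrite !expr0]. Qed.

(* The exponent is halved because x / (1 + x)^2 is nondecreasing on ]0, 1[. *)
Lemma regular_Tr K g : regular (2 * K) g -> regular K (Tr g).
Proof.
move=> [dg rg]; split.
  exact: density_Tr.
move=> x y x0 xy y1; have x1 := le_lt_trans xy y1; have y0 := lt_le_trans x0 xy.
have [_ _ g0] := dg.
have [] := rg ((1 + x) / 2) ((1 + y) / 2) ltac:(lra) ltac:(lra) ltac:(lra).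
have := g0 ((1 + x) / 2) ltac:(lra) ltac:(lra).
have := g0 ((1 + y) / 2) ltac:(lra) ltac:(lra).
rewrite /Tr !exprM; set A := ((1 + x) / 2) ^+ 2; set B := ((1 + y) / 2) ^+ 2.
set p := g ((1 + x) / 2); set q := g ((1 + y) / 2) => q0 p0 r1 r2.
have A0 : 0 < A by rewrite exprn_gt0//; lra.
have xByA : x * B <= y * A.
  rewrite -subr_ge0 (_ : _ - _ = (y - x) * (1 - x * y) / 4); last first.
    by rewrite /A /B; field.
  by rewrite divr_ge0// mulr_ge0 ?subr_ge0// mulr_ile1// ltW.
have xByAK : (x * B) ^+ K <= (y * A) ^+ K.
  by rewrite lerXn2r// nnegrE mulr_ge0 ?exprn_ge0//; lra.
have AK : 0 < A ^+ K by rewrite exprn_gt0.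
rewrite !mulrA !ler_pM2r//; split; rewrite -(ler_pM2l AK).
  apply: (@le_trans _ _ (x ^+ K * (B ^+ K * q))).
    by rewrite mulrCA; apply: ler_wpM2l => //; exact/exprn_ge0/ltW.
  by rewrite !mulrA [A ^+ K * _]mulrC -!exprMn; apply: ler_wpM2r.
apply: (@le_trans _ _ (x ^+ K * (B ^+ K * p))).
  by rewrite mulrCA; apply: ler_wpM2l => //; exact/exprn_ge0/ltW.
by rewrite !mulrA [A ^+ K * _]mulrC -!exprMn; apply: ler_wpM2r.
Qed.

(** On [1/2, 1[ the variable ln x ranges over an interval of length ln 2. *)
Lemma regular_ratio K g x y : regular K g ->
  1 / 2 <= x -> x < 1 -> 1 / 2 <= y -> y < 1 -> g x <= 2 ^+ K * g y.
Proof.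
move=> rg x2 x1 y2 y1.
have g0 z : 1 / 2 <= z -> z < 1 -> 0 <= g z.
  by move=> z2 z1; apply: (regular_ge0 rg) => //; lra.
suff H u v : 1 / 2 <= u -> 0 <= v -> v <= 1 -> u ^+ K * g x <= v ^+ K * g y ->
    g x <= 2 ^+ K * g y.
  have [xy|yx] := leP x y.
    by have [? _] := rg.2 x y ltac:(lra) xy y1; apply: (H x y) => //; lra.
  by have [_ ?] := rg.2 y x ltac:(lra) (ltW yx) x1; apply: (H y x) => //; lra.
move=> u2 v0 v1 uv.
have h1 : (1 / 2) ^+ K * g x <= g y.
  apply: (@le_trans _ _ (u ^+ K * g x)).
    by rewrite ler_wpM2r ?g0// lerXn2r ?nnegrE//; lra.
  by apply: le_trans uv _; rewrite ler_piMl ?g0// exprn_ile1.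
rewrite -[leLHS](_ : 2 ^+ K * ((1 / 2) ^+ K * g x) = _).
  by rewrite ler_wpM2l// exprn_ge0.
by rewrite mulrA -exprMn mul1r divff ?expr1n ?mul1r.
Qed.

Section regular_Tl.
Context (alpha : R).
Hypothesis alpha01 : 0 < alpha < 1.

(* With s = lpow u and t = lpow v this rests on the monotonicity of
   (1 + s)^K / (1 + (1 + alpha) s) on [0, 1], which needs K >= 2. *)
Let Tl_ineq K (u v s t p q : R) : 0 < u -> u <= v -> 0 <= s -> s <= t ->
  t <= 1 -> 0 <= p -> 0 <= q ->
  u ^+ K.+2 * p <= v ^+ K.+2 * q -> u ^+ K.+2 * q <= v ^+ K.+2 * p ->
  (u * (1 + s)) ^+ K.+2 * (p / (1 + (1 + alpha) * s)) <=
  (v * (1 + t)) ^+ K.+2 * (q / (1 + (1 + alpha) * t)) /\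
  (u * (1 + s)) ^+ K.+2 * (q / (1 + (1 + alpha) * t)) <=
  (v * (1 + t)) ^+ K.+2 * (p / (1 + (1 + alpha) * s)).
Proof.
have := alpha01 => /andP[a0 a1].
move=> u0 uv s0 st t1 p0 q0 r1 r2.
have s1 : 0 <= 1 + s by rewrite addr_ge0.
have as0 : 0 <= (1 + alpha) * s by rewrite mulr_ge0//; lra.
have ast : (1 + alpha) * s <= (1 + alpha) * t by rewrite ler_wpM2l//; lra.
have ds : 0 < 1 + (1 + alpha) * s by rewrite ltr_pwDl.
have dt : 0 < 1 + (1 + alpha) * t by rewrite ltr_pwDl// (le_trans as0).
have key : (1 + s) ^+ 2 / (1 + (1 + alpha) * s) <=
           (1 + t) ^+ 2 / (1 + (1 + alpha) * t).
  rewrite ler_pdivrMr// mulrAC ler_pdivlMr// -subr_ge0.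
  have -> : (1 + t) ^+ 2 * (1 + (1 + alpha) * s) -
    (1 + s) ^+ 2 * (1 + (1 + alpha) * t) =
    (t - s) * (1 - alpha + t + s + (1 + alpha) * (s * t)) by ring.
  have : 0 <= (1 + alpha) * (s * t) by rewrite !mulr_ge0//; lra.
  by move=> ?; apply: mulr_ge0; lra.
have stX n : (1 + s) ^+ n <= (1 + t) ^+ n.
  by rewrite lerXn2r ?nnegrE ?lerD2l// (le_trans s1)// lerD2l.
have sX n : 0 <= (1 + s) ^+ n by exact: exprn_ge0.
have uX : 0 <= u ^+ K.+2 by rewrite exprn_ge0// ltW.
have dsV : 0 <= (1 + (1 + alpha) * s)^-1 by rewrite invr_ge0 ltW.
have dtV : 0 <= (1 + (1 + alpha) * t)^-1 by rewrite invr_ge0 ltW.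
have keyK : (1 + s) ^+ K.+2 / (1 + (1 + alpha) * s) <=
           (1 + t) ^+ K.+2 / (1 + (1 + alpha) * t).
  have split2 z d : (1 + z) ^+ K.+2 / d = (1 + z) ^+ K * ((1 + z) ^+ 2 / d) :> R.
    by rewrite -addn2 exprD mulrA.
  rewrite !split2; apply: ler_pM key; [exact: sX| |exact: stX].
  by apply: mulr_ge0 dsV; exact: sX.
have tsV : (1 + (1 + alpha) * t)^-1 <= (1 + (1 + alpha) * s)^-1.
  by rewrite lef_pV2 ?posrE// lerD2l.
rewrite !exprMn; split.
  rewrite [leLHS](_ : _ = (u ^+ K.+2 * p) *
    ((1 + s) ^+ K.+2 / (1 + (1 + alpha) * s))); last by ring.
  rewrite [leRHS](_ : _ = (v ^+ K.+2 * q) *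
    ((1 + t) ^+ K.+2 / (1 + (1 + alpha) * t))); last by ring.
  by apply: ler_pM r1 keyK; apply: mulr_ge0.
rewrite [leLHS](_ : _ = (u ^+ K.+2 * q) *
  ((1 + s) ^+ K.+2 / (1 + (1 + alpha) * t))); last by ring.
rewrite [leRHS](_ : _ = (v ^+ K.+2 * p) *
  ((1 + t) ^+ K.+2 / (1 + (1 + alpha) * s))); last by ring.
apply: ler_pM r2 _; [exact: mulr_ge0|exact: mulr_ge0|].
by apply: ler_pM tsV; [exact: sX|exact: dtV|exact: stX].
Qed.

Lemma regular_Tl K g : regular K.+2 g -> regular K.+2 (Tl alpha g).
Proof.
have := alpha01 => /andP[a0 a1].
move=> [dg rg]; split; first exact: density_Tl.
move=> x y x0 xy y1; have x1 := le_lt_trans xy y1; have y0 := lt_le_trans x0 xy.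
have [_ _ g0] := dg.
have /andP[u0 u2] := linv_itv alpha01 x0 x1.
have /andP[v0 v2] := linv_itv alpha01 y0 y1.
have uv := linv_nondecreasing alpha01 xy.
have [r1 r2] := rg _ _ u0 uv ltac:(lra).
have := Tl_ineq u0 uv (lpow_ge0 alpha _) (lpow_le alpha01 (ltW u0) uv)
  (lpow_le1 alpha01 (ltW v0) (ltW v2)) (g0 _ u0 ltac:(lra)) (g0 _ v0 ltac:(lra))
  r1 r2.
rewrite -[linv alpha x * _]/(lbranch alpha (linv alpha x)).
rewrite -[linv alpha y * _]/(lbranch alpha (linv alpha y)).
by rewrite (linvK alpha01 x0 (ltW x1)) (linvK alpha01 y0 (ltW y1)).
Qed.

End regular_Tl.

End transfer.
Arguments lefth {R}.
Arguments righth {R}.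
Arguments measurable_lefth {R}.
Arguments measurable_righth {R}.

(** * Avoiding the gate *)

Section avoidance.
Context (R : realType) (alpha : R).
Hypothesis alpha01 : 0 < alpha < 1.
Local Notation T := (measurableTypeR R).
Local Notation f := (lsv alpha).
Local Notation one := (fun=> 1 : R).
Implicit Types (u v g : R -> R) (x b s : R).

(* An orbit outside [0, b[ can enter [0, b[ only through gate b. *)
Definition gate (b : R) : set T := `[1 / 2, (1 + b) / 2[%classic.

Fixpoint avoid b k : set T :=
  if k is k'.+1 then ~` gate b `&` f @^-1` avoid b k' else setT.

Fixpoint stay n : set T :=
  if n is n'.+1 then lefth `&` f @^-1` stay n' else setT.

Definition endpoint n : R := iter n (linv alpha) 1.

Lemma measurable_gate b : measurable (gate b).
Proof. exact: measurable_itv. Qed.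

Lemma measurable_avoid b k : measurable (avoid b k).
Proof.
elim: k => [|k IH] /=; first exact: measurableT.
apply: measurableI; last exact: measurable_lsv_preimage.
by apply: measurableC; exact: measurable_gate.
Qed.

Lemma measurable_stay n : measurable (stay n).
Proof.
elim: n => [|n IH] /=; first exact: measurableT.
by apply: measurableI; [exact: measurable_lefth|exact: measurable_lsv_preimage].
Qed.

Local Hint Resolve measurable_gate measurable_avoid measurable_stay
  measurable_lefth measurable_righth measurableT : core.

Lemma avoid_antitone b k j : (k <= j)%N -> avoid b j `<=` avoid b k.
Proof.
elim: k j => [//|k IH] [//|j] kj x /= [nA fx]; split => //.
exact: (IH j kj).
Qed.

Lemma lefth_gate b : lefth `<=` ~` gate b.
Proof.
by move=> x; rewrite /lefth /gate /= !in_itv/= => x2 /andP[]; rewrite leNgt x2.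
Qed.

Lemma gate_righth b : gate b `<=` righth.
Proof. by move=> x; rewrite /gate /righth/= !in_itv/= andbT => /andP[]. Qed.

Lemma endpoint_itv n : 0 < endpoint n <= 1.
Proof.
elim: n => [|n /andP[a0 a1]]; first by rewrite /= ltr01 lexx.
rewrite /endpoint iterS linv_gt0//=.
by rewrite (le_trans (linv_le_half _ _)) //; lra.
Qed.

(** The left branch is increasing from ]0, 1/2[ onto ]0, 1[, so n stays on the left mean lying below
    the n-th left preimage of 1. *)
Lemma stayE n : stay n `&` `]0, 1[ = `]0, endpoint n[ `&` `]0, 1[.
Proof.
apply/seteqP; split => x [xs x01]; split => //;
  move: x01 xs; rewrite [X in X -> _]/= in_itv/= => /andP[x0 x1].
  elim: n x x0 x1 => [|n IH] x x0 x1 /=; first by rewrite in_itv/= x0 x1.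
  move=> []; rewrite /lefth/= !in_itv/= => x2.
  have fx0 : 0 < f x by rewrite lsv_left// -(lbranch0 alpha) lbranch_lt.
  have fx1 : f x < 1 by rewrite lsv_left// -(lbranch_half alpha) lbranch_lt// ltW.
  move=> /(IH _ fx0 fx1); rewrite /= !in_itv/= fx0 x0/= lsv_left//.
  have /andP[? ?] := endpoint_itv n.
  by rewrite linv_lt_iff// ltW.
elim: n x x0 x1 => [//|n IH] x x0 x1 /=.
rewrite in_itv/= x0/= => xa.
have x2 : x < 1 / 2 by apply: lt_le_trans xa (linv_le_half _ _).
have fx0 : 0 < f x by rewrite lsv_left// -(lbranch0 alpha) lbranch_lt.
have fx1 : f x < 1 by rewrite lsv_left// -(lbranch_half alpha) lbranch_lt// ltW.
split; first by rewrite /lefth/= in_itv.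
apply: IH => //=; rewrite in_itv/= fx0/= lsv_left//.
have /andP[? ?] := endpoint_itv n.
by rewrite -linv_lt_iff// ltW.
Qed.

Lemma mass_stay g n : mass g (stay n) = mass g `]0, endpoint n[%classic.
Proof. by apply: eq_mass_set; exact: stayE. Qed.

(** The gate lies in the right half, so n steps spent on the left avoid it for free. *)
Lemma mass_iter_Tl b n k g : density g ->
  mass (iter n (Tl alpha) g) (avoid b k) = mass g (stay n `&` avoid b (n + k)).
Proof.
elim: n g => [|n IH] g dg; first by rewrite /= setTI.
rewrite iterSr IH; last exact: density_Tl.
rewrite mass_Tl//; last exact: measurableI.
congr (mass g _); rewrite addSn /= preimage_setI.
apply/seteqP; split => x /=; first by move=> [xl [xs xa]]; do 2?split => //; exact: lefth_gate.
by move=> [[xl xs] [_ xa]].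
Qed.

(** The recursion behind every decomposition by the first visit to [1/2, 1[: mass on the right is
    kept, mass on the left moves on by one step. *)
Lemma mass_avoid_step b k v : density v ->
  mass v (avoid b k.+1) = mass v (righth `&` avoid b k.+1) + mass (Tl alpha v) (avoid b k).
Proof.
move=> dv; rewrite (massID dv (measurable_avoid b k.+1) measurable_lefth) addrC.
rewrite setC_lefth [_ `&` righth]setIC; congr (_ + _).
rewrite mass_Tl//; congr (mass v _); apply/seteqP; split => x /=.
  by move=> [[_ ?] ?].
by move=> [xl ?]; do 2?split => //; exact: lefth_gate.
Qed.

Lemma mass_split v : density v ->
  mass v setT = mass v righth + mass (Tl alpha v) setT.
Proof.
move=> dv; rewrite (massID dv measurableT measurable_lefth) addrC !setTI.
by rewrite setC_lefth mass_Tl// preimage_setT setIT.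
Qed.

Lemma mass1_righth : mass one righth = 1 / 2.
Proof.
rewrite (@eq_mass_set _ one righth `[1 / 2, 1[).
  by rewrite mass1_itv//; lra.
apply/seteqP; split => x [/=]; rewrite /righth/= !in_itv/= andbT.
  by move=> -> /andP[-> ->].
by move=> /andP[-> ->].
Qed.

(** The mean of [u] over [1/2, 1[ is [2 * mass u righth], and [regular_ratio] compares it with each
    value. *)
Lemma regular_sup K u x : regular K u -> 1 / 2 <= x -> x < 1 ->
  u x <= 2 ^+ K * (2 * mass u righth).
Proof.
move=> ru x2 x1.
have ux0 : 0 <= u x by apply: (regular_ge0 ru) => //; lra.
have k0 : (0 : R) < 2 ^+ K by rewrite exprn_gt0.
have : u x / 2 ^+ K * mass one righth <= mass u righth.
  apply: mass_ge_cst => //; first exact: regular_density ru.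
    by rewrite divr_ge0// exprn_ge0.
  move=> y; rewrite /righth/= in_itv/= andbT => y2 y0 y1.
  by rewrite ler_pdivrMr// mulrC; exact: (regular_ratio ru).
rewrite mass1_righth mulrAC ler_pdivrMr// => h.
have -> : u x = 2 * (u x * (1 / 2)) by field.
rewrite [leRHS](_ : _ = 2 * (mass u righth * 2 ^+ K)); last by ring.
by rewrite ler_wpM2l.
Qed.

Lemma regular_inf K u x : regular K u -> 1 / 2 <= x -> x < 1 ->
  2 * mass u righth <= 2 ^+ K * u x.
Proof.
move=> ru x2 x1.
have ux0 : 0 <= u x by apply: (regular_ge0 ru) => //; lra.
have k0 : (0 : R) <= 2 ^+ K by rewrite exprn_ge0.
have : mass u righth <= (2 ^+ K * u x) * mass one righth.
  apply: mass_le_cst => //; first exact: regular_density ru.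
    by rewrite mulr_ge0.
  move=> y; rewrite /righth/= in_itv/= andbT => y2 y0 y1.
  exact: (regular_ratio ru).
by rewrite mass1_righth; lra.
Qed.

Fixpoint pre k (E : set T) : set T :=
  if k is k'.+1 then f @^-1` pre k' E else E.

Lemma measurable_pre k E : measurable E -> measurable (pre k E).
Proof. by move=> mE; elim: k => //= k IH; exact: measurable_lsv_preimage. Qed.

Definition transfer (g : R -> R) (x : R) : R := Tl alpha g x + Tr g x.

Lemma density_transfer g : density g -> density (transfer g).
Proof. by move=> dg; apply: densityD; [exact: density_Tl|exact: density_Tr]. Qed.

Lemma density_iter_transfer k g : density g -> density (iter k transfer g).
Proof. by move=> dg; elim: k => //= k; exact: density_transfer. Qed.

Lemma mass_pre k g E : density g -> measurable E ->
  mass g (pre k E) = mass (iter k transfer g) E.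
Proof.
elim: k g => [//|k IH] g dg mE; rewrite iterSr -IH//; last exact: density_transfer.
by rewrite /= mass_lsv_preimage//; exact: measurable_pre.
Qed.

Lemma regular_transfer g : regular 2 g -> regular 2 (transfer g).
Proof.
move=> rg; apply: regularD; first exact: regular_Tl.
by apply: regular_Tr; apply: regularW rg.
Qed.

Lemma regular_iter_transfer k g : regular 2 g -> regular 2 (iter k transfer g).
Proof. by move=> rg; elim: k => //= k; exact: regular_transfer. Qed.

Lemma regular_iter_Tl n K g : regular K.+2 g -> regular K.+2 (iter n (Tl alpha) g).
Proof. by move=> rg; elim: n => //= n; exact: regular_Tl. Qed.

Lemma mass1_gate b : 0 < b -> b <= 1 -> mass one (gate b) = b / 2.
Proof. by move=> b0 b1; rewrite mass1_itv//; lra. Qed.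

Lemma mass_gate_le b K u : 0 < b -> b <= 1 -> regular K u ->
  mass u (gate b) <= 2 ^+ K * b * mass u righth.
Proof.
move=> b0 b1 ru; have du := regular_density ru.
apply: le_trans (mass_le_cst du (c := 2 ^+ K * (2 * mass u righth)) _ _ _) _ => //.
- by rewrite !mulr_ge0 ?exprn_ge0 ?mass_ge0.
- move=> x /gate_righth; rewrite /righth/= in_itv/= andbT => x2 x0 x1.
  exact: regular_sup.
- by rewrite mass1_gate// le_eqVlt; apply/orP; left; apply/eqP; field.
Qed.

(** The bound is uniform in [k] because the constant density stays 2-regular under [transfer], and a
    2-regular density cannot concentrate on the gate. *)
Lemma mass1_pre_gate b k : 0 < b -> b <= 1 -> mass one (pre k (gate b)) <= 4 * b.
Proof.
move=> b0 b1; have d1 : density one by exact: density_cst.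
rewrite mass_pre//.
have r1 : regular 2 (iter k transfer one).
  by apply: regular_iter_transfer; apply: regularW (regular_cst ler01).
apply: le_trans (mass_gate_le b0 b1 r1) _.
have h : mass (iter k transfer one) righth <= 1.
  apply: (@le_trans _ _ (mass (iter k transfer one) setT)).
    by apply: le_mass_set => //; exact: regular_density r1.
  rewrite -mass_pre//; apply: (@le_trans _ _ (mass one setT)).
    by apply: le_mass_set => //; exact: measurable_pre.
  rewrite (@eq_mass_set _ one setT `]0, 1[) ?mass1_itv ?subr0//.
  by rewrite setTI setIid.
have : b * mass (iter k transfer one) righth <= b * 1 by rewrite ler_wpM2l// ltW.
by rewrite expr2; lra.
Qed.

Lemma avoid_sub_pre b k : avoid b k `<=` avoid b k.+1 `|` pre k (gate b).
Proof.
elim: k => [|k IH] x /=.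
  by move=> _; have [?|?] := pselect (gate b x); [right|left].
move=> [nA /IH[[? ?]|?]]; last by right.
by left; do 2?split.
Qed.

(** Each additional step loses only points that are in the gate at one given time; by
    [mass1_pre_gate] they have Lebesgue measure at most 4 b, whatever the time. *)
Lemma mass_avoid_shift b k j u s : 0 < b -> b <= 1 -> density u -> 0 <= s ->
  (forall x, 1 / 2 <= x -> x < 1 -> u x <= s) ->
  mass u (righth `&` avoid b k) <=
  mass u (righth `&` avoid b (k + j)) + j%:R * (4 * s * b).
Proof.
move=> b0 b1 du s0 us; elim: j => [|j IH]; first by rewrite addn0 mul0r addr0.
apply: (le_trans IH).
have -> : j.+1%:R = j%:R + 1 :> R by rewrite natr1.
rewrite addnS; set m := (k + j)%N.
suff : mass u (righth `&` avoid b m) <=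
  mass u (righth `&` avoid b m.+1) + 4 * s * b by lra.
have mrpre : measurable (righth `&` pre m (gate b)).
  by apply: measurableI => //; exact: measurable_pre.
have mra i : measurable (righth `&` avoid b i) by exact: measurableI.
have mD : measurable ((righth `&` pre m (gate b)) `\` (righth `&` avoid b m.+1)).
  exact: measurableD.
apply: (@le_trans _ _ (mass u ((righth `&` avoid b m.+1) `|`
    ((righth `&` pre m (gate b)) `\` (righth `&` avoid b m.+1))))).
  apply: le_mass_set => //; first exact: measurableU.
  move=> x [xr /avoid_sub_pre[xa|xp]]; first by left.
  by have [?|?] := pselect ((righth `&` avoid b m.+1) x); [left|right].
rewrite mass_setU// ?setDIK//; rewrite lerD2l.
apply: (@le_trans _ _ (mass u (righth `&` pre m (gate b)))).
  by apply: le_mass_set => // x [].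
apply: le_trans (mass_le_cst du s0 mrpre _) _.
  by move=> x [+ _]; rewrite /righth/= in_itv/= andbT => x2 x0 x1; exact: us.
rewrite [leRHS](_ : _ = s * (4 * b)); last by ring.
rewrite ler_wpM2l//; apply: le_trans _ (mass1_pre_gate m b0 b1).
apply: le_mass_set; [exact: density_cst|exact: mrpre|exact: measurable_pre|].
by move=> x [].
Qed.

(* On [1/2, 1[ this is the density, at the first visit to [1/2, 1[, of the mass
   that gets there in fewer than n steps from the initial density v. *)
Fixpoint slsum n (v : R -> R) : R -> R :=
  if n is n'.+1 then fun x => v x + slsum n' (Tl alpha v) x else fun=> 0.

Lemma regular_slsum n v : regular 2 v -> regular 2 (slsum n v).
Proof.
elim: n v => [|n IH] v rv /=; first by apply: regularW (regular_cst (lexx 0)).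
by apply: regularD => //; apply: IH; exact: regular_Tl.
Qed.

Lemma mass_slsum n v : regular 2 v ->
  mass (slsum n v) righth = mass v setT - mass v (stay n).
Proof.
elim: n v => [|n IH] v rv /=; have dv := regular_density rv.
  by rewrite subrr mass_cst// mul0r.
have rTl := regular_Tl alpha01 rv.
rewrite massD//; last exact: regular_density (regular_slsum n rTl).
by rewrite IH// (mass_split dv) [mass _ (stay n)]mass_Tl//; ring.
Qed.

(** Mass first visiting the right half at time i < n has n + k - i steps left instead of k, a shift
    by at most n; [stay n] is the mass yet to arrive. The 32 is the 4 of [mass_avoid_shift] times
    the 8 of [regular_sup] at exponent 2. *)
Lemma mass_avoid_slsum b n k v : 0 < b -> b <= 1 -> regular 2 v ->
  `|mass v (avoid b (n + k)) - mass (slsum n v) (righth `&` avoid b k)| <=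
  n%:R * (32 * b) * mass v setT + mass v (stay n).
Proof.
move=> b0 b1; have mra i : measurable (righth `&` avoid b i) by exact: measurableI.
elim: n v => [|n IH] v rv; have dv := regular_density rv.
  rewrite add0n /= mass_cst// !mul0r subr0 add0r ger0_norm ?mass_ge0//.
  by apply: le_mass_set.
have rTl := regular_Tl alpha01 rv; have dTl := regular_density rTl.
rewrite addSn mass_avoid_step//= massD//; last first.
  exact: regular_density (regular_slsum n rTl).
have := IH _ rTl; rewrite (mass_split dv).
have -> : mass (Tl alpha v) (stay n) = mass v (stay n.+1) by rewrite mass_Tl.
have hr := mass_ge0 righth dv; have hl := mass_ge0 setT dTl.
have le1 : mass v (righth `&` avoid b (n + k).+1) <= mass v (righth `&` avoid b k).
  apply: le_mass_set => // x [xr xa]; split => //.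
  exact: (avoid_antitone (leqW (leq_addl _ _)) xa).
have : mass v (righth `&` avoid b k) <= mass v (righth `&` avoid b (n + k).+1) +
    n.+1%:R * (4 * (4 * (2 * mass v righth)) * b).
  rewrite -addSn [(n.+1 + k)%N]addnC; apply: mass_avoid_shift => //.
    by rewrite !mulr_ge0.
  move=> x x2 x1; apply: le_trans (regular_sup rv x2 x1) _.
  by rewrite expr2; lra.
have -> : n.+1%:R = n%:R + 1 :> R by rewrite natr1.
have : 0 <= n%:R * (32 * b) * mass v righth by rewrite !mulr_ge0// ltW.
have : 0 <= (32 * b) * mass (Tl alpha v) setT by rewrite !mulr_ge0// ltW.
set p := mass _ _; set q := mass _ _.
rewrite !ler_norml => h1 h2 h3 /andP[h4 h5]; apply/andP; split; lra.
Qed.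

End avoidance.

(** * Loss of memory under the return map to [1/2, 1[ *)

Section forgetting.
Context (R : realType) (alpha : R).
Hypothesis alpha01 : 0 < alpha < 1.
Local Notation T := (measurableTypeR R).
Local Notation f := (lsv alpha).
Local Notation one := (fun=> 1 : R).
Local Notation avoid := (avoid alpha).
Local Notation stay := (stay alpha).
Local Notation endpoint := (endpoint alpha).
Implicit Types (u v g : R -> R) (x b s : R).

Local Hint Resolve measurable_gate measurable_avoid measurable_stay
  measurable_lefth measurable_righth measurableT : core.

(* The probability of avoiding gate b under the uniform law on [1/2, 1[. *)
Definition survival b k : R := mass (fun=> 2) (righth `&` avoid b k).

Let mra b i : measurable (righth `&` avoid b i).
Proof. exact: measurableI. Qed.

Lemma survivalE b k : survival b k = 2 * mass one (righth `&` avoid b k).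
Proof. exact: mass_cst. Qed.

Lemma survival_ge0 b k : 0 <= survival b k.
Proof. by rewrite mass_ge0//; exact: density_cst. Qed.

Lemma survival_le1 b k : survival b k <= 1.
Proof.
rewrite survivalE.
have : mass one (righth `&` avoid b k) <= mass one righth.
  by apply: le_mass_set => //; exact: density_cst.
by rewrite mass1_righth; lra.
Qed.

Lemma survival0 b : survival b 0 = 1.
Proof. by rewrite survivalE/= setIT mass1_righth; field. Qed.

Lemma survival_shift b k j : 0 < b -> b <= 1 ->
  survival b (k + j) <= survival b k <= survival b (k + j) + j%:R * (8 * b).
Proof.
move=> b0 b1; have d2 : density (fun=> 2 : R) by exact: density_cst.
apply/andP; split.
  apply: le_mass_set => // x [xr xa]; split => //.
  exact: (avoid_antitone (leq_addr _ _) xa).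
have := @mass_avoid_shift R alpha alpha01 b k j _ 2 b0 b1 d2 _ _.
by rewrite (_ : 4 * 2 = 8 :> R); last ring; apply.
Qed.

(** Subtracting at most half of a function at most doubles the Lipschitz constant of its logarithm:
    dU / (U - c) is at most 2 dU / U. *)
Let cut_ineq (P Q U V c : R) : 0 <= P -> P <= Q -> 0 <= c -> 2 * c <= U ->
  2 * c <= V -> P * U <= Q * V -> P ^+ 2 * (U - c) <= Q ^+ 2 * (V - c).
Proof.
move=> P0 PQ c0 cU cV h; have Q0 := le_trans P0 PQ.
have [h2|h2] := leP (2 * c * Q) (P * U).
  have : Q * (P * U) <= Q * (Q * V) by rewrite ler_wpM2l.
  have : 0 <= (Q - P) * (P * U - 2 * c * Q) by rewrite mulr_ge0 ?subr_ge0.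
  have : 0 <= c * (Q - P) ^+ 2 by rewrite mulr_ge0// sqr_ge0.
  by rewrite !expr2 => *; nra.
have : P * (P * U) <= P * (2 * c * Q) by rewrite ler_wpM2l// ltW.
have : 0 <= Q ^+ 2 * (V - 2 * c) by rewrite mulr_ge0 ?sqr_ge0// subr_ge0.
have : 0 <= c * (Q - P) ^+ 2 by rewrite mulr_ge0// sqr_ge0.
by rewrite !expr2 => *; nra.
Qed.

(* A 2-regular u dominates u (1 / 2) / 4 on [1/2, 1[, so half of that constant
   can be split off at the price of passing to 4-regular functions; prolonging by
   a constant to the left of 1/2 keeps the remainder bounded. *)
Definition remainder u x : R := u (Num.max x (1 / 2)) - u (1 / 2) / 8.

Lemma regular_remainder u : regular 2 u -> regular 4 (remainder u).
Proof.
move=> ru; have du := regular_density ru; have [mu _ u0] := du.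
have uh0 : 0 <= u (1 / 2) by apply: u0; lra.
have ul x : 1 / 2 <= x -> x < 1 -> 2 * (u (1 / 2) / 8) <= u x.
  by move=> x2 x1; have := @regular_ratio _ 2 u (1 / 2) x ru _ _ _ _; lra.
have uu x : 1 / 2 <= x -> x < 1 -> u x <= 4 * u (1 / 2).
  move=> x2 x1; have := @regular_ratio _ 2 u x (1 / 2) ru _ _ _ _.
  by rewrite (_ : 2 ^+ 2 = 4 :> R); [apply; lra|ring].
have cut x : x < 1 -> 1 / 2 <= Num.max x (1 / 2) < 1.
  by move=> x1; rewrite le_max lexx orbT gt_max x1; lra.
split.
  apply: (@density_le _ _ (fun=> 4 * u (1 / 2))).
  - by apply: density_cst; lra.
  - apply: measurable_funB; last exact: measurable_cst.
    apply: (measurableT_comp mu); apply: measurable_maxr => //.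
  - move=> x x0 x1; rewrite /remainder; have /andP[c2 c1] := cut x x1.
    by have := ul _ c2 c1; have := uu _ c2 c1; lra.
move=> x y x0 xy y1; have x1 := le_lt_trans xy y1.
have /andP[p2 p1] := cut x x1; have /andP[q2 q1] := cut y y1.
rewrite /remainder; set c := u (1 / 2) / 8.
have c0 : 0 <= c by rewrite /c; lra.
have pq : Num.max x (1 / 2) <= Num.max y (1 / 2).
  by rewrite ge_max !le_max xy lexx orbT.
(* Truncation at 1/2 shortens distances in ln x, so bounds at the truncated points carry over to [x]
   and [y]. *)
have xqyp : x * Num.max y (1 / 2) <= y * Num.max x (1 / 2).
  rewrite /Num.max; case: ifPn; case: ifPn; rewrite -?leNgt => *; nra.
move: p2 p1 q2 q1 pq xqyp; set p := Num.max x _; set q := Num.max y _.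
move=> p2 p1 q2 q1 pq xqyp.
have [r1 r2] := ru.2 p q ltac:(lra) pq q1.
have y0 := lt_le_trans x0 xy.
have PQ : p ^+ 2 <= q ^+ 2 by rewrite lerXn2r// nnegrE; lra.
have P0 : 0 <= p ^+ 2 by exact: sqr_ge0.
have main U V : 2 * c <= U -> 2 * c <= V -> p ^+ 2 * U <= q ^+ 2 * V ->
    x ^+ 4 * (U - c) <= y ^+ 4 * (V - c).
  move=> cU cV UV; have := cut_ineq P0 PQ c0 cU cV UV.
  rewrite -!exprM => h.
  have q4 : 0 < q ^+ 4 by rewrite exprn_gt0//; lra.
  rewrite -(ler_pM2l q4); apply: (@le_trans _ _ (y ^+ 4 * (p ^+ 4 * (U - c)))).
    rewrite [leLHS](_ : _ = (x * q) ^+ 4 * (U - c)); last by ring.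
    rewrite [leRHS](_ : _ = (y * p) ^+ 4 * (U - c)); last by ring.
    apply: ler_wpM2r; first by lra.
    by rewrite lerXn2r// nnegrE; apply: mulr_ge0; lra.
  by rewrite [leRHS]mulrCA; apply: ler_wpM2l => //; rewrite exprn_ge0// ltW.
by split; apply: main => //; apply: ul.
Qed.

Lemma mass_remainder u E : regular 2 u -> measurable E -> E `<=` righth ->
  mass u E = mass (remainder u) E + u (1 / 2) / 8 * mass one E.
Proof.
move=> ru mE Er; have u0 : 0 <= u (1 / 2) by apply: (regular_ge0 ru); lra.
rewrite -mass_cst// -massD//; last 2 first.
- exact: regular_density (regular_remainder ru).
- by apply: density_cst; lra.
apply: eq_mass => x /Er; rewrite /righth/= in_itv/= andbT => x2 _ _.
by rewrite /remainder (max_idPl x2) subrK.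
Qed.

(* Returning to [1/2, 1[ moves all times by at most N.+1 steps, up to the mass
   staying away longer; this hardly changes avoidance probabilities because the
   gate is small.  The constant split off after the return is a fixed fraction,
   at least 1/32, of the mass. *)
Lemma forget_step b N k g (d : R) : 0 < b -> b <= 1 -> 0 <= d ->
  (forall g', regular 4 g' ->
    `|mass g' (righth `&` avoid b k) - mass g' righth * survival b k| <=
    d * mass g' righth) ->
  regular 4 g ->
  `|mass g (righth `&` avoid b k) - mass g righth * survival b k| <=
  (200 * (N.+1)%:R * b + 32 * endpoint N + 31 / 32 * d) * mass g righth.
Proof.
move=> b0 b1 d0 hd rg; have dg := regular_density rg.
have rv : regular 2 (Tr g) by apply: regular_Tr.
have dv := regular_density rv.
set M := mass g righth; set th := survival b k.
have M0 : 0 <= M by exact: mass_ge0.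
have th0 : 0 <= th := survival_ge0 b k.
have th1 : th <= 1 := survival_le1 b k.
have gM x : 1 / 2 <= x -> x < 1 -> g x <= 32 * M.
  by move=> x2 x1; have := regular_sup rg x2 x1; rewrite -/M; lra.
have vT : mass (Tr g) setT = M.
  by rewrite (@mass_Tr R alpha)// preimage_setT setIT.
have vS : mass (Tr g) (stay N) <= 16 * M * endpoint N.
  have /andP[? ?] := endpoint_itv alpha01 N.
  rewrite mass_stay//; apply: le_trans (mass_le_cst dv (c := 16 * M) _ _ _) _ => //.
  - by lra.
  - by move=> x _ x0 x1; rewrite /Tr; have := gM ((1 + x) / 2) ltac:(lra) ltac:(lra); lra.
  - by rewrite mass1_itv// ?subr0//; lra.
have vS0 : 0 <= mass (Tr g) (stay N) by exact: mass_ge0.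
(* Per unit of M b, the shift costs 128 (N + 1), the gate at time 0 costs 16 and the return costs 32
   N; 200 (N + 1) covers them. The mass not back in time is at most 16 M [endpoint N] and enters
   twice, hence 32. *)
have h1 : mass g (righth `&` avoid b k) <= mass g (righth `&` avoid b (k + N.+1))
    + N.+1%:R * (4 * (32 * M) * b).
  by apply: mass_avoid_shift => //; lra.
have h1' : mass g (righth `&` avoid b (k + N.+1)) <= mass g (righth `&` avoid b k).
  apply: le_mass_set => // x [xr xa]; split => //.
  exact: (avoid_antitone (leq_addr _ _) xa).
have mrf : measurable (righth `&` f @^-1` avoid b (N + k)).
  by apply: measurableI => //; exact: measurable_lsv_preimage.
have h2 : mass (Tr g) (avoid b (N + k)) <= mass g (righth `&` avoid b (k + N.+1))
    + 16 * b * M.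
  rewrite (@mass_Tr R alpha)// addnS [(k + N)%N]addnC.
  apply: (@le_trans _ _ (mass g (righth `&` avoid b (N + k).+1 `|` gate b))).
    apply: le_mass_set => //; first exact: measurableU.
    move=> x [xr xa]; have [?|?] := pselect (gate b x); [by right|left].
    by split.
  rewrite mass_setU//; last first.
    by rewrite -subset0 => x [[_ [+ _]] +]; exact.
  rewrite lerD2l; apply: le_trans (mass_gate_le b0 b1 rg) _.
  by rewrite -/M; lra.
have h2' : mass g (righth `&` avoid b (k + N.+1)) <= mass (Tr g) (avoid b (N + k)).
  rewrite (@mass_Tr R alpha)// addnS [(k + N)%N]addnC.
  apply: le_mass_set => //.
  by move=> x [xr [_ xa]].
have := mass_avoid_slsum alpha01 N k b0 b1 rv.
have := mass_slsum alpha01 N rv; rewrite vT.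
have ru := regular_slsum alpha01 N rv.
set u := slsum alpha N (Tr g) in ru * => uE h3.
have uM : mass u righth <= M by lra.
have u2 := @regular_inf R 2 u (1 / 2) ru ltac:(lra) ltac:(lra).
have e1 := mass_remainder ru (mra b k) (@subIsetl _ _ _).
have e2 := mass_remainder ru measurable_righth (@subset_refl _ righth).
have := hd _ (regular_remainder ru).
move: e1 e2; rewrite mass1_righth; set c := u (1 / 2) / 8.
have -> : mass one (righth `&` avoid b k) = th / 2.
  by rewrite /th survivalE; field.
set r := mass (remainder u) (righth `&` avoid b k).
set rM := mass (remainder u) righth.
rewrite -/th => e1 e2 h4.
have uth : mass u righth * th <= M * th by rewrite ler_wpM2r.
have vSth : mass (Tr g) (stay N) * th <= mass (Tr g) (stay N) by rewrite ler_piMr.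
have vSth0 : 0 <= mass (Tr g) (stay N) * th by rewrite mulr_ge0.
(* The constant [c] is at least 1/16 of the mass of [u] on the right half, which has length 1/2;
   splitting it off removes at least 1/32 of that mass. *)
have rMle : d * rM <= d * (31 / 32 * M).
  by rewrite ler_wpM2l//; rewrite /c in e2; lra.
have Mb0 : 0 <= M * b by rewrite mulr_ge0// ltW.
have -> : N.+1%:R = N%:R + 1 :> R by rewrite natr1.
have NMb : 0 <= N%:R * (M * b) by rewrite mulr_ge0.
have N1 : N.+1%:R = N%:R + 1 :> R by rewrite natr1.
rewrite N1 in h1.
move: h3 h4; rewrite e1 !ler_norml => /andP[h3 h3'] /andP[h4 h4'].
have ME : M = rM + c * (1 / 2) + mass (Tr g) (stay N) by lra.
have MthE : M * th = rM * th + c * (1 / 2) * th + mass (Tr g) (stay N) * th.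
  by rewrite ME; ring.
apply/andP; split; lra.
Qed.

(** Iterating d := e + 31/32 d, which [forget_step] allows, from the trivial bound leaves only the
    fixed point 32 e. *)
Lemma forget b N k g : 0 < b -> b <= 1 -> regular 4 g ->
  `|mass g (righth `&` avoid b k) - mass g righth * survival b k| <=
  32 * (200 * (N.+1)%:R * b + 32 * endpoint N) * mass g righth.
Proof.
move=> b0 b1 rg; set e := 200 * _ * b + _.
have /andP[a0 _] := endpoint_itv alpha01 N.
have e0 : 0 <= e by rewrite /e addr_ge0 ?mulr_ge0// ltW.
have M0 (h : R -> R) : regular 4 h -> 0 <= mass h righth.
  by move=> /regular_density; exact: mass_ge0.
have : forall m (h : R -> R), regular 4 h ->
    `|mass h (righth `&` avoid b k) - mass h righth * survival b k| <=
    (32 * e + (31 / 32) ^+ m) * mass h righth.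
  elim=> [|m IH] h rh.
    have dh := regular_density rh; have h0 := M0 _ rh.
    have : mass h (righth `&` avoid b k) <= mass h righth by exact: le_mass_set.
    have : 0 <= mass h (righth `&` avoid b k) by exact: mass_ge0.
    have : mass h righth * survival b k <= mass h righth.
      by rewrite ler_piMr// survival_le1.
    have : 0 <= mass h righth * survival b k by rewrite mulr_ge0// survival_ge0.
    have : 0 <= 32 * e * mass h righth by rewrite !mulr_ge0.
    by rewrite expr0 ler_norml => *; apply/andP; split; lra.
  apply: le_trans (forget_step N b0 b1 _ IH rh) _.
    by rewrite addr_ge0 ?mulr_ge0// exprn_ge0.
  rewrite -/e exprS; apply: ler_wpM2r; first exact: M0.
  by rewrite mulrDr; lra.
move=> H; apply/ler_addgt0Pr => eps eps0.
have /cvgrPdist_le/(_ (eps / (mass g righth + 1)) _) :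
    (31 / 32 : R) ^+ n @[n --> \oo] --> 0.
  by apply: cvg_expr; rewrite ger0_norm; lra.
case; first by rewrite divr_gt0// ltr_pwDr// M0.
move=> m _ /(_ m (leqnn m)); rewrite sub0r normrN ger0_norm ?exprn_ge0// => hm.
apply: le_trans (H m _ rg) _; rewrite mulrDl lerD2l.
apply: (@le_trans _ _ (eps / (mass g righth + 1) * (mass g righth + 1))).
  by apply: ler_pM => //; rewrite ?exprn_ge0 ?M0 ?lerDl.
by rewrite divfK// gt_eqF// ltr_pwDr// M0.
Qed.

End forgetting.
(** * Escape from the fixed point *)

Section endpoint_asymptotics.
Context (R : realType) (alpha : R).
Hypothesis alpha01 : 0 < alpha < 1.
Local Notation endpoint := (endpoint alpha).
Local Notation lpow := (lpow alpha).

Lemma endpoint_gt0 n : 0 < endpoint n.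
Proof. by case/andP: (endpoint_itv alpha01 n). Qed.

Lemma endpoint_le1 n : endpoint n <= 1.
Proof. by case/andP: (endpoint_itv alpha01 n). Qed.

Lemma endpointS n : endpoint n = endpoint n.+1 * (1 + lpow (endpoint n.+1)).
Proof.
rewrite -[LHS](linvK alpha01 (endpoint_gt0 n) (endpoint_le1 n)).
by rewrite /endpoint -iterS.
Qed.

Lemma endpointS_le n : endpoint n.+1 <= endpoint n.
Proof.
by rewrite (endpointS n) ler_peMr ?lerDl ?lpow_ge0// ltW// endpoint_gt0.
Qed.

Lemma endpoint_antitone m n : (m <= n)%N -> endpoint n <= endpoint m.
Proof.
move=> /subnK <-; elim: (n - m)%N => [//|k IH].
by rewrite addSn; exact: le_trans (endpointS_le _) IH.
Qed.

Lemma endpointS_half n : endpoint n.+1 <= 1 / 2.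
Proof. by rewrite /endpoint iterS linv_le_half. Qed.

(** While the endpoints exceed [e], each step lowers them by at least [e * lpow e]. *)
Lemma endpoint_le_eventually e : 0 < e ->
  exists N, forall n, (N <= n)%N -> endpoint n <= e.
Proof.
move=> e0; have p0 := lpow_gt0 alpha e0.
have claim n : e < endpoint n -> endpoint n + n%:R * (e * lpow e) <= 1.
  elim: n => [|n IH] en; first by rewrite mul0r addr0.
  have := IH (lt_le_trans en (endpointS_le n)).
  rewrite {1}endpointS.
  have h : e * lpow e <= endpoint n.+1 * lpow (endpoint n.+1).
    by apply: ler_pM; rewrite ?lpow_ge0 ?lpow_le// ltW.
  have -> : n.+1%:R = n%:R + 1 :> R by rewrite natr1.
  by move=> *; lra.
pose N := (Num.truncn (e * lpow e)^-1).+1.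
exists N => n Nn; apply: le_trans (endpoint_antitone Nn) _.
rewrite leNgt; apply/negP => /[dup] eN /claim.
have : 1 < N%:R * (e * lpow e).
  have : (e * lpow e)^-1 < N%:R by exact: truncnS_gt.
  by rewrite -[ltLHS]mul1r ltr_pdivrMr// mulr_gt0.
by have := endpoint_gt0 N; lra.
Qed.

Lemma le_lpow K : 0 < K -> exists2 d, 0 < d &
  forall a, 0 < a -> a <= d -> K * a <= lpow a.
Proof.
have /andP[al0 al1] := alpha01.
(* The point where a^(1 - alpha) = 1 / K; below it K a is at most a^alpha. *)
move=> K0; exists (K^-1 `^ (1 - alpha)^-1).
  by apply: powR_gt0; rewrite invr_gt0.
move=> a a0 ad.
have h : a `^ (1 - alpha) <= K^-1.
  have -> : K^-1 = (K^-1 `^ (1 - alpha)^-1) `^ (1 - alpha).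
    rewrite -powRrM mulVf ?powRr1 ?invr_ge0 ?(ltW K0)//.
    by rewrite gt_eqF// subr_gt0.
  by apply: ge0_ler_powR; rewrite ?nnegrE ?powR_ge0 ?subr_ge0 ?(ltW a0) ?(ltW al1).
have h2 : a = a `^ alpha * a `^ (1 - alpha).
  rewrite -powRD; first by rewrite addrC subrK powRr1// ltW.
  by rewrite addrC subrK oner_eq0.
apply: (@le_trans _ _ (a `^ alpha)).
  rewrite {1}h2 mulrCA -[leRHS]mulr1; apply: ler_wpM2l; first exact: powR_ge0.
  by rewrite mulrC -ler_pdivlMr// div1r.
rewrite /lpow ler_peMl ?powR_ge0//.
rewrite -[leLHS](powRr0 2); apply: ler_powR; last exact: ltW.
by rewrite ler1n.
Qed.

Lemma lpow_small e : 0 < e -> exists2 d, 0 < d &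
  forall a, 0 <= a -> a <= d -> lpow a <= e.
Proof.
have /andP[al0 al1] := alpha01.
move=> e0; exists (e `^ alpha^-1 / 2); first by rewrite divr_gt0 ?powR_gt0.
move=> a a0 ad; rewrite /lpow -powRM//.
apply: (@le_trans _ _ ((e `^ alpha^-1) `^ alpha)).
  rewrite ge0_ler_powR ?nnegrE ?mulr_ge0 ?powR_ge0//; [exact: ltW|].
  by rewrite mulrC -ler_pdivlMr.
by rewrite -powRrM mulVf ?gt_eqF// powRr1// ltW.
Qed.

(* The increments of 1 / endpoint n tend to +oo because alpha < 1. *)
Lemma endpoint_mul_small e : 0 < e ->
  exists N, forall n, (N <= n)%N -> n%:R * endpoint n <= e.
Proof.
move=> e0; pose K := 4 / e; have K0 : 0 < K by rewrite divr_gt0.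
have [d d0 hd] := le_lpow K0.
have [N hN] := endpoint_le_eventually d0.
have claim m : m%:R * (K / 2) <= (endpoint (m + N))^-1.
  elim: m => [|m IH]; first by rewrite mul0r invr_ge0 ltW// endpoint_gt0.
  rewrite addSn; set a := endpoint _.+1.
  have a0 : 0 < a by exact: endpoint_gt0.
  have aE := endpointS (m + N).
  have s0 : 0 <= lpow a by exact: lpow_ge0.
  have s1 : lpow a <= 1.
    by apply: lpow_le1 => //; [exact: ltW|exact: endpointS_half].
  have sK : K * a <= lpow a by apply: hd => //; apply: hN; lia.
  (* The increment is lpow a / (a (1 + lpow a)), at least K / 2 since K a <= lpow a <= 1. *)
  have -> : a^-1 = (endpoint (m + N))^-1 + lpow a / endpoint (m + N).
    by rewrite aE -/a; field; rewrite !gt_eqF//; lra.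
  have -> : m.+1%:R = m%:R + 1 :> R by rewrite natr1.
  rewrite mulrDl lerD// mul1r ler_pdivlMr ?endpoint_gt0// aE -/a.
  have : lpow a * (K * a) <= 1 * (K * a) by rewrite ler_wpM2r// mulr_ge0// ltW.
  by lra.
(* From here on n <= 2 (n - N), and 4 / K = e. *)
exists (2 * N).+1 => n nN; have := claim (n - N)%N.
rewrite subnK; last by lia.
have a0 := endpoint_gt0 n.
rewrite -[(endpoint n)^-1]mul1r ler_pdivlMr// => h.
have nN2 : (n%:R : R) <= 2 * (n - N)%:R by rewrite -natrM ler_nat; lia.
have : n%:R * endpoint n <= 2 * (n - N)%:R * endpoint n by rewrite ler_wpM2r// ltW.
have : e * ((n - N)%:R * (K / 2) * endpoint n) <= e * 1 by rewrite ler_wpM2l// ltW.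
rewrite [X in X <= _](_ : _ = 2 * (n - N)%:R * endpoint n); last first.
  by rewrite /K; field; rewrite gt_eqF.
by lra.
Qed.

(** [J] is long enough for all but a fraction of order e of ]0, b[ to reach the right half, and
    short enough for the gate to be negligible during [J] steps. It is the first index with
    [endpoint J <= e * b]: minimality bounds (J - 1) e b by (J - 1) times the preceding endpoint, at
    most e^2 / 2. *)
Lemma endpoint_window e : 0 < e -> exists2 d, 0 < d &
  forall b, 0 < b -> b <= d -> exists J, endpoint J <= e * b /\ J%:R * b <= e.
Proof.
move=> e0; have [N hN] := @endpoint_mul_small (e ^+ 2 / 2) ltac:(by rewrite divr_gt0// exprn_gt0).
exists (endpoint N.+1 / (2 * e)).
  by rewrite divr_gt0 ?endpoint_gt0 ?mulr_gt0.
move=> b b0 bd; have eb0 : 0 < e * b by rewrite mulr_gt0.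
have ebN : e * b < endpoint N.+1.
  have := endpoint_gt0 N.+1; move: bd; rewrite ler_pdivlMr ?mulr_gt0//; lra.
have ex : exists J, endpoint J <= e * b.
  by have [J hJ] := endpoint_le_eventually eb0; exists J; exact: hJ.
case: (ex_minnP ex) => J aJ Jmin; exists J; split => //.
have NJ : (N.+1 < J)%N.
  rewrite ltnNge; apply/negP => /endpoint_antitone; rewrite leNgt.
  by rewrite (le_lt_trans aJ).
case: J aJ Jmin NJ => [//|J] aJ Jmin NJ.
have aJ' : e * b < endpoint J.
  by rewrite ltNge; apply/negP => /Jmin; rewrite ltnn.
have hJ := hN J (ltac:(lia)).
have J1 : (1 : R) <= J%:R by rewrite ler1n; lia.
have h1 : J%:R * (e * b) <= J%:R * endpoint J by rewrite ler_wpM2l// ltW.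
have h2 : 1 * (e * b) <= J%:R * (e * b) by rewrite ler_wpM2r// ltW.
rewrite -(ler_pM2l e0).
have -> : J.+1%:R = J%:R + 1 :> R by rewrite natr1.
by move: hJ; rewrite expr2; lra.
Qed.

(** Makes ]0, b[ a set [stay n] up to a proportion [lpow b], because consecutive endpoints around
    [b] are that close. *)
Lemma endpoint_bracket b : 0 < b -> b < 1 -> exists n,
  [/\ endpoint n <= b, b - endpoint n <= b * lpow b
    & forall J, endpoint J <= b -> (n <= J)%N].
Proof.
move=> b0 b1; have ex : exists J, endpoint J <= b.
  by have [J hJ] := endpoint_le_eventually b0; exists J; exact: hJ.
case: (ex_minnP ex) => n an nmin; exists n; split => //.
case: n an nmin => [|n] an nmin; first by move: an; rewrite leNgt b1.
have bn : b < endpoint n by rewrite ltNge; apply/negP => /nmin; rewrite ltnn.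
have a0 := endpoint_gt0 n.+1.
have : endpoint n.+1 * lpow (endpoint n.+1) <= b * lpow b.
  by apply: ler_pM; rewrite ?lpow_ge0 ?lpow_le// ltW.
by have := endpointS n; lra.
Qed.

End endpoint_asymptotics.
(** * Approximation of the invariant measure *)

Section lipschitz_approximation.
Context (R : realType).
Local Notation T := (measurableTypeR R).

Lemma heine01 (g : R -> R) (e : R) : 0 < e -> continuous g ->
  exists2 d, 0 < d & forall x y, 0 <= x <= 1 -> `|x - y| < d -> `|g x - g y| <= e.
Proof.
move=> e0 cg.
have c01 : compact (`[0%R, 1%R]%classic : set R) by exact: segment_compact.
have /compact_near_coveringP ncov := c01.
have /ncov : forall x : R, `[0%R, 1%R]%classic x -> \forall x' \near x & d \near (0 : R)^'+,
    forall y, `|x' - y| < d -> `|g x' - g y| <= e.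
  move=> x _.
  have /cvgrPdist_lt/(_ (e / 2) ltac:(by rewrite divr_gt0)) := cg x.
  move=> /nbhs_ballP[r /= r0 hr].
  exists (ball x (r / 2), [set d | d < r / 2]).
    split => /=; first by apply: nbhsx_ballx; rewrite divr_gt0.
    by apply: nbhs_right_lt; rewrite divr_gt0.
  move=> [x' d] /= [xx' dr] y xy.
  have rr : r / 2 < r by lra.
  have h1 := hr x' (le_ball (ltW rr) xx').
  have h2 : `|g x - g y| < e / 2.
    apply: hr; rewrite /ball/=; move: xx'; rewrite /ball/= => xx'.
    rewrite (_ : x - y = (x - x') + (x' - y)); last by ring.
    by apply: le_lt_trans (ler_normD _ _) _; lra.
  rewrite (_ : g x' - g y = (g x - g y) - (g x - g x')); last by ring.
  by apply: le_trans (ler_normB _ _) _; lra.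
move=> [r /= r0 hr]; exists (r / 2); first by rewrite divr_gt0.
move=> x y x01; apply: (hr (r / 2)); rewrite /ball/= ?sub0r ?normrN//.
- by rewrite ger0_norm ?divr_ge0 ?ltW//; lra.
- by rewrite divr_gt0.
Qed.

(** The Pasch-Hausdorff envelope, that is, the largest L-Lipschitz function below [G] on [0, 1]; it
    inherits lower bounds of [G]. *)
Definition inf_conv (G : R -> R) (L x : R) : R :=
  inf [set G y + L * `|x - y| | y in `[0, 1]].

Lemma lipschitz_approx (g : R -> R) (c e : R) : continuous g ->
  (forall x, 0 <= x <= 1 -> c <= g x) -> 0 < e ->
  exists (v : R -> R) (L : R), [/\ 0 <= L,
    forall x y, v x <= v y + L * `|x - y|,
    forall x, 0 <= x <= 1 -> c <= v x
    & forall x, 0 <= x <= 1 -> v x <= g x <= v x + e].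
Proof.
move=> cg gc e0.
have [d d0 hd] := heine01 e0 cg.
have [z z01 gz] : exists2 z, z \in `[0, 1] & forall t, t \in `[0, 1] -> g t <= g z.
  by apply: EVT_max; [exact: ler01|exact: continuous_subspaceT].
have gzc : c <= g z by apply: gc; rewrite in_itv in z01.
(* With this slope a point at distance at least [d] contributes at least c + L d = g z, the maximum
   of [g], so only nearby points can lower the infimum below [g x]. *)
pose L := (g z - c) / d.
have L0 : 0 <= L by rewrite divr_ge0 ?subr_ge0// ltW.
pose S x := [set g y + L * `|x - y| | y in `[0, 1]].
have S0 x : nonempty (S x).
  by exists (g 0 + L * `|x - 0|), 0 => //=; rewrite in_itv/= lexx ler01.
have Sc x : lbound (S x) c.
  move=> _ [y + <-]; rewrite /= in_itv/= => y01.
  by rewrite (le_trans (gc y y01))// lerDl mulr_ge0.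
have hS x : has_lbound (S x) by exists c.
exists (inf_conv g L), L; split => //.
- move=> x y; rewrite -lerBlDr; apply: (lb_le_inf (S0 y)) => _ [t t01 <-].
  rewrite lerBlDr; apply: le_trans (ge_inf (hS x) _) _; first by exists t.
  rewrite -addrA lerD2l -mulrDr ler_wpM2l//.
  rewrite (_ : x - t = (x - y) + (y - t)); last by ring.
  by rewrite addrC; apply: le_trans (ler_normD _ _) _; rewrite addrC.
- by move=> x x01; apply: (lb_le_inf (S0 x)).
- move=> x x01; apply/andP; split.
    apply: (le_trans (ge_inf (hS x) (_ : S x (g x)))).
      by exists x; rewrite //= ?in_itv//= subrr normr0 mulr0 addr0.
    exact: lexx.
  rewrite -lerBlDr; apply: (lb_le_inf (S0 x)) => _ [y + <-]; rewrite /= in_itv/= => y01.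
  have [xy|xy] := ltP `|x - y| d.
    have := hd x y x01 xy; rewrite ler_norml => /andP[_ ?].
    have : 0 <= L * `|x - y| by rewrite mulr_ge0.
    by lra.
  have : g x <= g z by apply: gz; rewrite in_itv.
  have : c <= g y by exact: gc.
  have : L * d <= L * `|x - y| by rewrite ler_wpM2l.
  by rewrite {1}/L divfK ?gt_eqF//; lra.
Qed.

(** Bernoulli's inequality for y / x, weakened by (y - x) / x >= y - x. *)
Lemma bernoulli_ratio (K : nat) (x y : R) : 0 < x -> x <= y -> x <= 1 ->
  x ^+ K * (1 + K%:R * (y - x)) <= y ^+ K.
Proof.
move=> x0 xy x1; elim: K => [|K IH]; first by rewrite !expr0 mul0r addr0 mulr1.
have y0 := lt_le_trans x0 xy.
have : y * (x ^+ K * (1 + K%:R * (y - x))) <= y * y ^+ K by rewrite ler_wpM2l// ltW.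
rewrite -exprS; apply: le_trans.
have xK : x ^+ K.+1 <= x ^+ K by rewrite ler_wiXn2l// ltW.
have xK0 : 0 <= x ^+ K by rewrite exprn_ge0// ltW.
have h1 : x ^+ K.+1 * (y - x) <= x ^+ K * (y - x) by rewrite ler_wpM2r// subr_ge0.
have h2 : 0 <= x ^+ K * (K%:R * (y - x) ^+ 2).
  by rewrite mulr_ge0// mulr_ge0// sqr_ge0.
have -> : K.+1%:R = K%:R + 1 :> R by rewrite natr1.
move: h1 h2; rewrite !exprS expr0 mulr1 => h1 h2.
by rewrite [leRHS](_ : _ = x * x ^+ K * (1 + K%:R * (y - x)) +
  x ^+ K * (y - x) + x ^+ K * (K%:R * ((y - x) * (y - x)))); [lra|ring].
Qed.

(** Where [v] is at least [c], ln v is L / c-Lipschitz in x, hence also in ln x, since distances in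
    ln x are larger on ]0, 1[. *)
Lemma regular_lipschitz (v : R -> R) (c L B : R) (K : nat) : 0 < c ->
  (forall x, 0 <= x <= 1 -> c <= v x <= B) -> 0 <= L -> L <= c * K%:R ->
  (forall x y, v x <= v y + L * `|x - y|) -> regular K v.
Proof.
move=> c0 vc L0 LK vL.
have cv : continuous v.
  move=> x; apply/cvgrPdist_le => e e0.
  have L1 : 0 < L + 1 by rewrite ltr_pwDr.
  exists (e / (L + 1)) => /=; first by rewrite divr_gt0.
  move=> y /=; rewrite /ball/= => xy.
  have h : L * `|x - y| <= e.
    have : (L + 1) * `|x - y| <= (L + 1) * (e / (L + 1)).
      by rewrite ler_wpM2l// ltW.
    have : 0 <= `|x - y| by [].
    by rewrite mulrCA divff ?gt_eqF// mulr1; lra.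
  have := vL x y; have := vL y x; rewrite [`|y - x|]distrC ler_norml => *.
  by apply/andP; split; lra.
have mv : measurable_fun (setT : set T) (v : T -> T).
  exact: continuous_measurable_fun.
split.
  apply: (@density_le _ _ (fun=> B)) => //.
    apply: density_cst; have := vc 0; rewrite lexx ler01 => /(_ erefl)/andP[]; lra.
  move=> x x0 x1; have /andP[h1 h2] : c <= v x <= B by apply: vc; rewrite !ltW.
  by rewrite h2 andbT; lra.
move=> x y x0 xy y1; have y0 := lt_le_trans x0 xy; have x1 := le_lt_trans xy y1.
have key s t : c <= v s -> v t <= v s + L * (y - x) ->
    x ^+ K * v t <= y ^+ K * v s.
  move=> cs vst; have d0 : 0 <= y - x by rewrite subr_ge0.
  have Ld : L * (y - x) <= c * K%:R * (y - x) by rewrite ler_wpM2r.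
  have cd : c * (K%:R * (y - x)) <= v s * (K%:R * (y - x)).
    by rewrite ler_wpM2r// mulr_ge0.
  have vs0 : 0 <= v s by lra.
  have := ler_wpM2r vs0 (bernoulli_ratio K x0 xy (ltW x1)); apply: le_trans.
  rewrite -mulrA; apply: ler_wpM2l; first by rewrite exprn_ge0// ltW.
  by lra.
have vx : c <= v x by have /andP[] : c <= v x <= B by apply: vc; rewrite !ltW.
have vy : c <= v y by have /andP[] : c <= v y <= B by apply: vc; rewrite !ltW.
have xyE : `|x - y| = y - x by rewrite distrC ger0_norm// subr_ge0.
have yxE : `|y - x| = y - x by rewrite ger0_norm// subr_ge0.
by split; apply: key => //; [rewrite -xyE|rewrite -yxE]; apply: vL.
Qed.

End lipschitz_approximation.

(** * Lowering the exponent of regularity by iterating the transfer operator *)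

Section regularization.
Context (R : realType) (alpha : R).
Hypothesis alpha01 : 0 < alpha < 1.
Local Notation T := (measurableTypeR R).
Local Notation f := (lsv alpha).
Local Notation one := (fun=> 1 : R).
Local Notation stay := (stay alpha).
Local Notation endpoint := (endpoint alpha).
Local Notation transfer := (transfer alpha).
Implicit Types (u v w g : R -> R) (x b s e : R).

Local Hint Resolve measurable_gate measurable_avoid measurable_stay
  measurable_lefth measurable_righth measurableT : core.

(** Regularity alone allows growth at 0; the bound makes the mass near 0 at most proportional to
    length. *)
Definition bounded_regular K v := regular K v /\
  exists2 B, 0 <= B & forall x, 0 < x -> x < 1 -> v x <= B.

Lemma bounded_regular_Tl K v : (2 <= K)%N -> bounded_regular K v ->
  bounded_regular K (Tl alpha v).
Proof.
case: K => [//|[//|K]] _ [rv [B B0 vB]]; split; first exact: regular_Tl.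
exists B => // x x0 x1; have /andP[l0 l1] := linv_itv alpha01 x0 x1.
have l1' : linv alpha x < 1 by lra.
apply: le_trans (vB _ l0 l1'); rewrite /Tl ler_pdivrMr.
  by rewrite ler_peMr ?lslope_ge1//; exact: (regular_ge0 rv).
exact: lt_le_trans (lslope_ge1 alpha01 _).
Qed.

Lemma bounded_regular_Tr K v : bounded_regular (2 * K) v ->
  bounded_regular K (Tr v).
Proof.
move=> [rv [B B0 vB]]; split; first exact: regular_Tr.
exists B => // x x0 x1; rewrite /Tr.
by have := vB ((1 + x) / 2) ltac:(lra) ltac:(lra); lra.
Qed.

Lemma bounded_regularD K u v : bounded_regular K u -> bounded_regular K v ->
  bounded_regular K (fun x => u x + v x).
Proof.
move=> [ru [B B0 uB]] [rv [C C0 vC]]; split; first exact: regularD.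
exists (B + C); first exact: addr_ge0.
by move=> x x0 x1; rewrite lerD ?uB ?vC.
Qed.

Lemma bounded_regularW K K' v : (K <= K')%N -> bounded_regular K v ->
  bounded_regular K' v.
Proof. by move=> KK' [rv bv]; split => //; exact: regularW rv. Qed.

Lemma bounded_regular_cst c : 0 <= c -> bounded_regular 0 (fun=> c).
Proof. by move=> c0; split; [exact: regular_cst|exists c]. Qed.

Lemma bounded_regular_iter_transfer N v : bounded_regular 2 v ->
  bounded_regular 2 (iter N transfer v).
Proof.
move=> rv; elim: N => //= N IH; apply: bounded_regularD.
  exact: bounded_regular_Tl.
by apply: bounded_regular_Tr; apply: bounded_regularW IH.
Qed.

Lemma mass_stay_le K v : bounded_regular K v ->
  exists2 B, 0 <= B & forall M, mass v (stay M) <= B * endpoint M.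
Proof.
move=> [rv [B B0 vB]]; exists B => // M.
have /andP[a0 a1] := endpoint_itv alpha01 M.
rewrite mass_stay//; apply: le_trans (mass_le_cst (regular_density rv) B0 _ _) _ => //.
  by move=> x _; exact: vB.
by rewrite mass1_itv// ?subr0// ltW.
Qed.

Lemma mass_stay_small K v e : bounded_regular K v -> 0 < e ->
  exists M, mass v (stay M) <= e.
Proof.
move=> /mass_stay_le[B B0 hB] e0.
have B1 : 0 < B + 1 by rewrite ltr_pwDr.
have eB0 : 0 < e / (B + 1) by rewrite divr_gt0.
have [N hN] := endpoint_le_eventually alpha01 eB0.
exists N; apply: le_trans (hB N) _.
have := hN N (leqnn N); rewrite ler_pdivlMr// mulrC => /(le_trans _); apply.
by rewrite ler_wpM2r// ?lerDl// ltW// endpoint_gt0.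
Qed.

Lemma iter_transferD N u v :
  iter N transfer (fun x => u x + v x) =
  (fun x => iter N transfer u x + iter N transfer v x).
Proof.
elim: N => //= N ->; apply/funext => x.
by rewrite /transfer /Tl /Tr; ring.
Qed.

(** Here [e] is the mass that has not yet passed the right branch often enough. *)
Definition eventually_regular e v := exists N0, forall N, (N0 <= N)%N ->
  exists2 w, bounded_regular 2 w & forall E : set T, measurable E ->
    mass w E <= mass (iter N transfer v) E <= mass w E + e.

Lemma eventually_regular_step e1 e2 v : density v ->
  eventually_regular e1 (Tl alpha v) -> eventually_regular e2 (Tr v) ->
  eventually_regular (e1 + e2) v.
Proof.
move=> dv [N1 h1] [N2 h2]; exists (maxn N1 N2).+1 => -[//|N] NN.
have [w1 r1 hw1] := h1 N ltac:(lia); have [w2 r2 hw2] := h2 N ltac:(lia).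
exists (fun x => w1 x + w2 x); first exact: bounded_regularD.
move=> E mE; rewrite iterSr {2}/transfer iter_transferD.
have [d1 d2] := (regular_density r1.1, regular_density r2.1).
rewrite !massD//; last 2 first.
- by apply: density_iter_transfer => //; exact: density_Tl.
- by apply: density_iter_transfer => //; exact: density_Tr.
by have := hw1 E mE; have := hw2 E mE; lra.
Qed.

Lemma eventually_regular_small e v : density v -> mass v setT <= e ->
  eventually_regular e v.
Proof.
move=> dv ve; exists 0%N => N _; exists (fun=> 0).
  by apply: bounded_regularW (bounded_regular_cst (lexx 0)).
move=> E mE; rewrite mass_cst// mul0r add0r mass_ge0/=; last first.
  exact: density_iter_transfer.
rewrite -mass_pre//; apply: le_trans _ ve.
by apply: le_mass_set => //; exact: measurable_pre.
Qed.

(** Every passage through the right branch halves the exponent, and nearly all mass makes one within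
    finitely many steps; [j] passages lead down to the exponent 2. *)
Lemma eventually_regularP j v e : bounded_regular (2 ^ j.+1) v -> 0 < e ->
  eventually_regular e v.
Proof.
elim: j v e => [|j IH] v e rv e0.
  exists 0%N => N _; exists (iter N transfer v).
    exact: bounded_regular_iter_transfer.
  by move=> E mE; rewrite lexx lerDl ltW.
(* [e1] pays for the mass still on the left after [M] steps. [e2] is the budget of the pieces that
   have passed the right branch; each departure takes half of what remains. *)
have inner M u e1 e2 : bounded_regular (2 ^ j.+2) u -> mass u (stay M) <= e1 ->
    0 < e2 -> eventually_regular (e1 + e2) u.
  elim: M u e1 e2 => [|M IHM] u e1 e2 ru ue1 e20; have du := regular_density ru.1.
    by apply: eventually_regular_small => //; move: ue1 => /= ?; lra.
  rewrite (_ : e1 + e2 = (e1 + e2 / 2) + e2 / 2); last by field.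
  apply: eventually_regular_step => //.
    apply: IHM; last by rewrite divr_gt0.
      apply: bounded_regular_Tl => //.
      by rewrite expnS -[X in (X <= _)%N]muln1 leq_mul2l expn_gt0.
    by rewrite mass_Tl.
  apply: IH; last by rewrite divr_gt0.
  by apply: bounded_regular_Tr; rewrite -expnS.
have e20 : 0 < e / 2 by rewrite divr_gt0.
have [M hM] := mass_stay_small rv e20.
by rewrite [e]splitr; apply: inner hM _.
Qed.

End regularization.

Section acip_approximation.
Context (R : realType) (alpha : R).
Hypothesis alpha01 : 0 < alpha < 1.
Variable mu : probability (measurableTypeR R) R.
Hypothesis hmu : acip (lsv alpha) mu.
Local Notation T := (measurableTypeR R).
Local Notation lam := (@lebesgue_measure R).

Definition prob (E : set T) : R := fine (mu E).

Lemma probE (E : set T) : measurable E -> mu E = (prob E)%:E.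
Proof. by move=> mE; rewrite /prob fineK// fin_num_measure. Qed.

Lemma prob_ge0 (E : set T) : 0 <= prob E.
Proof. by rewrite fine_ge0. Qed.

Lemma prob_le (E F : set T) : measurable E -> measurable F -> E `<=` F ->
  prob E <= prob F.
Proof.
by move=> mE mF EF; rewrite -lee_fin -!probE// le_measure// inE.
Qed.

Lemma prob_le1 (E : set T) : measurable E -> prob E <= 1.
Proof. by move=> mE; rewrite -lee_fin -probE// probability_le1. Qed.

Lemma probU (E F : set T) : measurable E -> measurable F -> E `&` F = set0 ->
  prob (E `|` F) = prob E + prob F.
Proof.
move=> mE mF EF; apply: EFin_inj; rewrite EFinD -!probE//; last exact: measurableU.
by rewrite measureU.
Qed.

Lemma probID (E F : set T) : measurable E -> measurable F ->
  prob E = prob (E `&` F) + prob (E `&` ~` F).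
Proof.
move=> mE mF; rewrite -probU.
- by rewrite -setIUr setUv setIT.
- exact: measurableI.
- by apply: measurableI => //; exact: measurableC.
- by rewrite setIACA setICr setI0.
Qed.

Lemma acip_setC01 : prob (~` `]0, 1[%classic) = 0.
Proof.
have [mu01 dom _] := hmu.
have m01 : measurable (`]0, 1[%classic : set T) by [].
have mc01 : measurable (`[0, 1]%classic : set T) by [].
have null (r : R) : mu [set r] = 0%E.
  have /null_content_dominatesP d := dom.
  by apply: d; [exact: measurable_set1|exact: lebesgue_measure_set1].
have p1 : prob `[0, 1]%classic = 1 by rewrite /prob mu01.
have p2 : prob `]0, 1[%classic = 1.
  have pn (r : R) : prob [set r] = 0 by rewrite /prob null.
  have h : `[0, 1]%classic = `]0, 1[ `|` ([set 0] `|` [set 1]) :> set T.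
    apply/seteqP; split => x /=; rewrite !in_itv/=.
      move=> /andP[]; rewrite le_eqVlt => /predU1P[<-|x0]; first by right; left.
      by rewrite le_eqVlt => /predU1P[->|x1]; [right; right|left; rewrite x0 x1].
    by move=> [/andP[? ?]|[->|->]]; rewrite ?lexx ?ler01// !ltW.
  have m0 : measurable ([set 0] : set T) by exact: measurable_set1.
  have m1 : measurable ([set 1] : set T) by exact: measurable_set1.
  have e1 : prob ([set 0] `|` [set 1]) = 0.
    rewrite probU ?pn ?addr0//.
    by rewrite -subset0 => x [/= -> /eqP]; rewrite eq_sym oner_eq0.
  have e2 : prob (`]0, 1[ `|` ([set 0] `|` [set 1])) =
            prob `]0, 1[%classic + prob ([set 0] `|` [set 1]).
    apply: probU => //; first exact: measurableU.
    by rewrite -subset0 => x [/= + [?|?]]; subst x; rewrite in_itv/= ltxx ?andbF.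
  by move: p1; rewrite h e2 e1 addr0.
have pT : prob setT = 1 by rewrite /prob probability_setT.
have := probID measurableT m01; rewrite !setTI pT p2; lra.
Qed.

Lemma prob_restrict (E : set T) : measurable E -> prob E = prob (E `&` `]0, 1[).
Proof.
move=> mE; have m01 : measurable (`]0, 1[%classic : set T) by [].
rewrite (probID mE m01); suff -> : prob (E `&` ~` `]0, 1[) = 0 by rewrite addr0.
apply/eqP; rewrite eq_le prob_ge0 andbT -[leRHS]acip_setC01; apply: prob_le.
- by apply: measurableI => //; exact: measurableC.
- exact: measurableC.
- by move=> x [].
Qed.

Lemma prob_preimage (E : set T) : measurable E ->
  prob (lsv alpha @^-1` E) = prob E.
Proof.
move=> mE; have [mu01 _ inv] := hmu.
have mfE := @measurable_lsv_preimage R alpha E mE.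
have mI : measurable (`[0, 1]%classic `&` lsv alpha @^-1` E : set T).
  exact: measurableI.
rewrite -[RHS]/(fine (mu E)) -inv// -/(prob _) (prob_restrict mfE) (prob_restrict mI).
congr (prob _); apply/seteqP; split => x /=; last by move=> [[]].
by move=> [xE x01]; do 2?split => //; exact: subset_itv_oo_cc x01.
Qed.

Lemma prob_pre N (E : set T) : measurable E -> prob (pre alpha N E) = prob E.
Proof.
move=> mE; elim: N => //= N IH; rewrite prob_preimage//; exact: measurable_pre.
Qed.

(** A continuous L1 approximation of the density of [mu] is raised to be bounded away from 0, then
    replaced by a Lipschitz function, which [regular_lipschitz] makes regular. *)
Lemma prob_density_approx (e : R) : 0 < e ->
  exists K v, bounded_regular K v /\
  forall E : set T, measurable E -> `|prob E - mass v E| <= e.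
Proof.
move=> e0; have [_ dom _] := hmu.
have c0 : 0 < e / 4 by rewrite divr_gt0.
have m01 : measurable (`]0, 1[%classic : set T) by [].
have mc01 : measurable (`[0, 1]%classic : set T) by [].
pose h0 := Radon_Nikodym_SigmaFinite.f mu lam.
pose h := fine \o h0.
have hE x : (h x)%:E = h0 x.
  by rewrite /h /= fineK//; exact: Radon_Nikodym_SigmaFinite.f_fin_num.
have hE' : EFin \o h = h0 by apply/funext.
have h_ge0 x : 0 <= h x by rewrite -lee_fin hE; exact: Radon_Nikodym_SigmaFinite.f_ge0.
have ih : lam.-integrable setT (EFin \o h).
  by rewrite hE'; exact: Radon_Nikodym_SigmaFinite.f_integrable.
have mh : measurable_fun (setT : set T) (h : T -> T).
  by apply/measurable_EFinP; exact: measurable_int ih.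
have dh : density h by split => //; exact: integrableS ih.
have probh (E : set T) : measurable E -> prob E = mass h E.
  move=> mE; rewrite prob_restrict// /prob /mass /Rintegral.
  rewrite (Radon_Nikodym_SigmaFinite.f_integral dom); last exact: measurableI.
  by congr fine; apply: eq_integral => x _; rewrite hE.
have [g_ [cg_ ig_ /fine_cvgP[finI /cvgrPdist_lt/(_ _ c0) near0]]] :
  exists g_ : (R -> R)^nat, [/\ forall n, continuous (g_ n),
    forall n, lam.-integrable `[0%R, 1%R] (EFin \o g_ n) &
    (\int[lam]_(z in `[0%R, 1%R]) `|(h z - g_ n z)%:E|)%E @[n --> \oo] --> 0%E].
  apply: approximation_continuous_integrable => //.
    by rewrite [X in (X < _)%E]lebesgue_measure_itv/= lte_fin ltr01 -EFinB ltry.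
  exact: integrableS ih.
have [n _ /(_ n (leqnn n))[fin_n near_n]] := filterI finI near0.
pose g := g_ n; have cg : continuous g := cg_ n.
have ch : continuous (fun x => `|g x|).
  by move=> x; apply: cvg_norm; exact: cg.
have [z z01 gz] : exists2 z, z \in `[0, 1] & forall t, t \in `[0, 1] -> `|g t| <= `|g z|.
  by apply: (@EVT_max R (fun x => `|g x|)); [exact: ler01|exact: continuous_subspaceT].
pose G x := Num.max (g x) 0 + e / 4.
have cG : continuous G.
  move=> x; apply: cvgD; last exact: cvg_cst.
  by apply: continuous_max; [exact: cg|exact: cst_continuous].
have Gc x : 0 <= x <= 1 -> e / 4 <= G x.
  by move=> _; rewrite /G lerDr le_max lexx orbT.
have [v [L [L0 vL vc vG]]] := lipschitz_approx cG Gc c0.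
pose B := `|g z| + e / 4.
have B0 : 0 <= B by rewrite /B addr_ge0// ltW.
have vB x : 0 <= x <= 1 -> e / 4 <= v x <= B.
  move=> x01; rewrite vc//=; have /andP[vGx _] := vG x x01.
  apply: (le_trans vGx); rewrite /G /B lerD2r ge_max normr_ge0 andbT.
  by rewrite (le_trans (ler_norm _))// gz// in_itv.
have LK : L <= e / 4 * (Num.truncn (L / (e / 4))).+1%:R.
  by rewrite mulrC -ler_pdivrMr// ltW// truncnS_gt.
have rv := regular_lipschitz c0 vB L0 LK vL.
exists (Num.truncn (L / (e / 4))).+1, v; split.
  split => //; exists B => // x x0 x1.
  by have /andP[] : e / 4 <= v x <= B by apply: vB; rewrite !ltW.
have dv := regular_density rv.
have mg : measurable_fun (setT : set T) (g : T -> T).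
  exact: continuous_measurable_fun.
have [mv _ v_ge0] := dv.
pose k x := `|h x - v x|; pose k0 x := `|h x - g x|.
have dk : density k.
  apply: (density_le (densityD dh dv)).
    by apply: measurableT_comp => //; exact: measurable_funB.
  move=> x x0 x1; rewrite /k normr_ge0/=; apply: le_trans (ler_normB _ _) _.
  by rewrite !ger0_norm// v_ge0.
have dk0 : density k0.
  apply: (density_le (densityD dh (density_cst (normr_ge0 (g z))))).
    by apply: measurableT_comp => //; exact: measurable_funB.
  move=> x x0 x1; rewrite /k0 normr_ge0/=; apply: le_trans (ler_normB _ _) _.
  by rewrite ger0_norm// lerD2l gz// in_itv/= !ltW.
have mk0 : mass k0 setT <= e / 4.
  have := near_n; rewrite sub0r normrN => /ltW.
  rewrite ger0_norm; last by rewrite fine_ge0// integral_ge0.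
  apply: le_trans; rewrite /mass /Rintegral setTI; apply: fine_le => //.
    by apply: integrable_fin_num => //; case: dk0.
  apply: ge0_subset_integral => //.
    apply/measurable_EFinP; apply: measurable_funTS.
    by apply: measurableT_comp => //; exact: measurable_funB.
    by move=> x _; rewrite lee_fin /k0.
  exact: subset_itv_oo_cc.
have mk : mass k setT <= e.
  have dc : density (fun=> e / 2) by apply: density_cst; rewrite divr_ge0 ?ltW.
  apply: (@le_trans _ _ (mass (fun x => k0 x + e / 2) setT)).
    apply: le_mass => //; first exact: densityD.
    move=> x _ x0 x1; rewrite /k /k0.
    have x01 : 0 <= x <= 1 by rewrite !ltW.
    have /andP[v1 v2] := vG x x01; have := h_ge0 x.
    move: v1 v2; rewrite /G ler_norml.
    have := ler_norm (h x - g x).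
    have := ler_norm (g x - h x); rewrite distrC.
    by rewrite /Num.max; case: ifPn; rewrite -?leNgt => *; apply/andP; split; lra.
  rewrite massD// mass_cst//.
  have -> : mass (fun=> 1 : R) setT = 1.
    rewrite (@eq_mass_set _ _ setT `]0, 1[) ?mass1_itv ?subr0//.
    by rewrite setTI setIid.
  by lra.
move=> E mE; rewrite probh//.
have kE : mass k E <= mass k setT by exact: le_mass_set.
have h1 : mass h E <= mass v E + mass k E.
  rewrite -massD//; apply: le_mass => //; first exact: densityD.
  by move=> x _ _ _; rewrite /k -lerBlDl ler_norm.
have h2 : mass v E <= mass h E + mass k E.
  rewrite -massD//; apply: le_mass => //; first exact: densityD.
  by move=> x _ _ _; rewrite /k distrC -lerBlDl ler_norm.
by rewrite ler_norml; apply/andP; split; lra.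
Qed.

(** By invariance pushing forward leaves [mu] where it is, so the approximation persists while its
    density becomes 2-regular. *)
Lemma prob_regular_approx (e : R) : 0 < e ->
  exists2 w, bounded_regular 2 w &
  forall E : set T, measurable E -> `|prob E - mass w E| <= e.
Proof.
move=> e0; have [|K [v [rv hv]]] := @prob_density_approx (e / 2); first by rewrite divr_gt0.
have rv' : bounded_regular (2 ^ K.+1) v.
  apply: bounded_regularW rv; apply: ltnW; apply: (leq_trans (ltnSn K)).
  exact/ltnW/ltn_expl.
have [|N0 hN] := @eventually_regularP R alpha alpha01 K v (e / 2) rv'.
  by rewrite divr_gt0.
have [w rw hw] := hN N0 (leqnn N0).
exists w => // E mE; have := hw E mE; have := hv _ (measurable_pre alpha N0 mE).
rewrite prob_pre// mass_pre//; last exact: regular_density rv.1.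
by rewrite !ler_norml => /andP[? ?] /andP[? ?]; apply/andP; split; lra.
Qed.

End acip_approximation.
(** * Avoidance probabilities for small gates *)

Section equidistribution.
Context (R : realType) (alpha : R).
Hypothesis alpha01 : 0 < alpha < 1.
Local Notation T := (measurableTypeR R).
Local Notation f := (lsv alpha).
Local Notation one := (fun=> 1 : R).
Local Notation avoid := (avoid alpha).
Local Notation stay := (stay alpha).
Local Notation endpoint := (endpoint alpha).
Local Notation survival := (survival alpha).
Local Notation lpow := (lpow alpha).
Implicit Types (u v w g : R -> R) (x b e d : R).

Local Hint Resolve measurable_gate measurable_avoid measurable_stay
  measurable_lefth measurable_righth measurableT : core.

Lemma mass_setI01 g (E : set T) : mass g (E `&` `]0, 1[) = mass g E.
Proof. by rewrite /mass -setIA setIid. Qed.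

(** In [forget], first [N] makes the endpoint term small, then [b] makes the other term small for
    this [N]. *)
Lemma forget_small e : 0 < e -> exists2 b0, 0 < b0 <= 1 &
  forall b, 0 < b -> b <= b0 -> forall k u, regular 2 u ->
  `|mass u (righth `&` avoid b k) - mass u righth * survival b k| <=
  e * mass u righth.
Proof.
move=> e0; have e1 : 0 < e / (2 * 32 * 32) by rewrite divr_gt0.
have [N hN] := endpoint_le_eventually alpha01 e1.
have aN := hN N (leqnn N).
have N0 : (0 : R) < N.+1%:R by rewrite ltr0n.
pose b0 := Num.min 1 (e / (2 * 32 * 200) / N.+1%:R).
have b00 : 0 < b0 by rewrite lt_min ltr01 !divr_gt0.
exists b0; first by rewrite b00 ge_min lexx.
move=> b bp; rewrite le_min => /andP[b1 bN] k u ru.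
have r4 : regular 4 u by apply: regularW ru.
apply: le_trans (forget alpha01 N k bp b1 r4) _.
apply: ler_wpM2r; first exact: mass_ge0 (regular_density ru).
move: bN; rewrite ler_pdivlMr// => bN.
lra.
Qed.

(** Mass first visiting the right half at time i < M is there compared with survival for k + M - i
    steps, and so for k steps after a shift; only mass in [stay M] escapes this. *)
Lemma equidistribution b k M v d : 0 < b -> b <= 1 -> 0 <= d ->
  (forall k u, regular 2 u ->
   `|mass u (righth `&` avoid b k) - mass u righth * survival b k| <=
   d * mass u righth) ->
  regular 2 v ->
  `|mass v (avoid b (k + M)) - mass v setT * survival b k| <=
  (d + M%:R * (8 * b)) * mass v setT + mass v (stay M).
Proof.
move=> b0 b1 d0 hd; elim: M v => [|M IH] v rv; have dv := regular_density rv.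
  have th0 := survival_ge0 alpha b k; have th1 := survival_le1 alpha b k.
  rewrite addn0 /= mul0r addr0.
  have : mass v (avoid b k) <= mass v setT by exact: le_mass_set.
  have : 0 <= mass v (avoid b k) by exact: mass_ge0.
  have vT := mass_ge0 setT dv.
  have : mass v setT * survival b k <= mass v setT by rewrite ler_piMr.
  have : 0 <= mass v setT * survival b k by rewrite mulr_ge0.
  have : 0 <= d * mass v setT by rewrite mulr_ge0.
  by rewrite ler_norml => *; apply/andP; split; lra.
have rTl := regular_Tl alpha01 rv; have dTl := regular_density rTl.
rewrite addnS mass_avoid_step// (mass_split alpha01 dv).
have := IH _ rTl; have := hd (k + M.+1)%N v rv.
have -> : mass (Tl alpha v) (stay M) = mass v (stay M.+1) by rewrite mass_Tl.
have /andP[s1 s2] := survival_shift alpha01 k M.+1 b0 b1.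
have hr := mass_ge0 righth dv; have hl := mass_ge0 setT dTl.
have h1 : mass v righth * survival b (k + M.+1) <= mass v righth * survival b k.
  by rewrite ler_wpM2l.
have h2 : mass v righth * survival b k <=
    mass v righth * (survival b (k + M.+1) + M.+1%:R * (8 * b)).
  by rewrite ler_wpM2l.
have h3 : 0 <= b * mass (Tl alpha v) setT by rewrite mulr_ge0// ltW.
have h4 : 0 <= M%:R * (b * mass v righth) by rewrite !mulr_ge0// ltW.
have h5 : 0 <= b * mass v righth by rewrite mulr_ge0// ltW.
move: h2; have -> : M.+1%:R = M%:R + 1 :> R by rewrite natr1.
rewrite addnS in h1 *; rewrite !ler_norml => h2 /andP[h6 h7] /andP[h8 h9].
by apply/andP; split; lra.
Qed.

Lemma mass_iter_Tl_stay n M g : density g ->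
  mass (iter n (Tl alpha) g) (stay M) = mass g (stay (n + M)).
Proof.
elim: n g => [//|n IH] g dg; rewrite iterSr IH; last exact: density_Tl.
by rewrite mass_Tl.
Qed.

Lemma gateE b : gate b = righth `&` f @^-1` `]-oo, b[ :> set T.
Proof.
apply/seteqP; split => x; rewrite /gate /righth /= !in_itv/= ?andbT.
  by move=> /andP[x2 xb]; split => //; rewrite lsv_right//; lra.
by move=> [x2]; rewrite lsv_right// x2 => xb; lra.
Qed.

(* Mass that has passed the gate sits in ]0, b[ and needs about b^(- alpha) steps
   to come back to [1/2, 1[, during which the gate is negligible as
   b * b^(- alpha) tends to 0. *)
Lemma mass_gate_avoid e : 0 < e -> exists2 b0, 0 < b0 <= 1 &
  forall b, 0 < b -> b <= b0 -> exists J, J%:R * b <= e /\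
  forall k w, regular 2 w ->
  `|mass w (gate b `&` f @^-1` avoid b (k + J)) -
    mass w (gate b) * survival b k| <= e * mass w (gate b).
Proof.
move=> e0; pose e1 := Num.min (1 / 2) (e / 100).
have e10 : 0 < e1 by rewrite lt_min !divr_gt0.
have [e1h e1e] : e1 <= 1 / 2 /\ e1 <= e / 100.
  by split; rewrite ge_min lexx ?orbT.
have [b1 /andP[b10 b11] hb1] := forget_small e10.
have [b2 b20 hb2] := lpow_small alpha01 e10.
have [b3 b30 hb3] := endpoint_window alpha01 e10.
pose b0 := Num.min (1 / 2) (Num.min b1 (Num.min b2 b3)).
have b00 : 0 < b0 by rewrite !lt_min b10 b20 b30 divr_gt0.
exists b0; first by rewrite b00 ge_min; apply/orP; left; lra.
move=> b bp; rewrite !le_min => /and4P[bh bb1 bb2 bb3].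
have b1' : b < 1 by lra.
have [J [aJ Jb]] := hb3 b bp bb3.
have [n [anb ban nJ]] := endpoint_bracket alpha01 bp b1'.
have lb := hb2 b (ltW bp) bb2.
have e1b : e1 * b <= b by rewrite ler_piMl ?(ltW bp)//; lra.
have nleJ : (n <= J)%N by apply: nJ; exact: le_trans aJ e1b.
exists J; split; first by lra.
move=> k w rw; have dw := regular_density rw.
have rv : regular 2 (Tr w) by apply: regular_Tr; apply: regularW rw.
have dv := regular_density rv.
pose U : set T := `]-oo, b[%classic.
have mU : measurable U by exact: measurable_itv.
have gE : mass w (gate b) = mass (Tr w) U by rewrite (@mass_Tr R alpha)// -gateE.
have qE : mass w (gate b `&` f @^-1` avoid b (k + J)) =
    mass (Tr w) (U `&` avoid b (k + J)).
  rewrite (@mass_Tr R alpha)//; last exact: measurableI.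
  by rewrite gateE -setIA preimage_setI.
rewrite gE qE; set v := Tr w in rv dv *; set m := mass v U.
have m0 : 0 <= m by exact: mass_ge0.
(* The right inverse branch maps ]0, 1[ into [1/2, 1[, so [v] is comparable to a constant even near
   0, and its mass in ]0, b[ is spread almost like length. *)
have vratio x y : 0 < x -> x < 1 -> 0 < y -> y < 1 -> v x <= 4 * v y.
  move=> x0 x1 y0 y1; rewrite /v /Tr.
  have := @regular_ratio R 2 w ((1 + x) / 2) ((1 + y) / 2) rw
    ltac:(lra) ltac:(lra) ltac:(lra) ltac:(lra).
  by rewrite (_ : 2 ^+ 2 = 4 :> R); [lra|ring].
have v0 x : 0 < x -> x < 1 -> 0 <= v x by exact: regular_ge0 rv.
have U1 : mass one U = b.
  rewrite (@eq_mass_set _ _ U `]0, b[) ?mass1_itv ?subr0//; [exact: ltW|exact: ltW|].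
  apply/seteqP; split => x /=; rewrite /U/= !in_itv/=.
    by move=> [-> /andP[-> ->]].
  by move=> [/andP[_ ->]].
have vsup x : 0 < x -> x < 1 -> v x <= 4 * m / b.
  move=> x0 x1; rewrite ler_pdivlMr//.
  have : v x / 4 * mass one U <= m.
    apply: mass_ge_cst => //; first by rewrite divr_ge0// v0.
    by move=> y _ y0 y1; have := vratio x y x0 x1 y0 y1; lra.
  by rewrite U1; lra.
have mb0 : 0 <= 4 * m / b by rewrite divr_ge0 ?mulr_ge0// ltW.
have vint a c : 0 <= a -> a <= c -> c <= 1 -> mass v `[a, c[%classic <= 4 * m / b * (c - a).
  move=> a0 ac c1; rewrite -(@mass1_itv R a c true true)//.
  by apply: mass_le_cst => // x _; exact: vsup.
have an0 := endpoint_gt0 alpha01 n; have aJ0 := endpoint_gt0 alpha01 J.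
have stayJ : mass v (stay J) <= 4 * e1 * m.
  rewrite mass_stay//; apply: (@le_trans _ _ (mass v `[0, endpoint J[%classic)).
    by apply: le_mass_set => // x; rewrite /= !in_itv/= => /andP[/ltW -> ->].
  apply: le_trans (vint 0 (endpoint J) (lexx 0) (ltW aJ0) (endpoint_le1 alpha01 J)) _.
  rewrite subr0 mulrAC ler_pdivrMr//.
  have : m * endpoint J <= m * (e1 * b) by rewrite ler_wpM2l.
  by lra.
have gap : mass v `[endpoint n, b[%classic <= 4 * e1 * m.
  apply: le_trans (vint _ _ (ltW an0) anb (ltW b1')) _.
  rewrite mulrAC ler_pdivrMr//.
  have : b * lpow b <= b * e1 by rewrite ler_wpM2l// ltW.
  have : m * (b - endpoint n) <= m * (b * lpow b) by rewrite ler_wpM2l.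
  have : m * (b * lpow b) <= m * (b * e1) by rewrite ler_wpM2l// ler_wpM2l// ltW.
  by lra.
have mSA i : measurable (stay n `&` avoid b i) by exact: measurableI.
have mUA i : measurable (U `&` avoid b i) by exact: measurableI.
have stayU : stay n `&` `]0, 1[ `<=` U.
  rewrite stayE// => x [/=]; rewrite /U/= !in_itv/= => /andP[_ xa] _.
  exact: lt_le_trans xa anb.
have cover : U `&` `]0, 1[ `<=` stay n `|` `[endpoint n, b[.
  move=> x [/=]; rewrite /U/= in_itv/= => xb x01.
  have [xa|xa] := ltP x (endpoint n); last by right; rewrite /= in_itv/= xa.
  left; have : (stay n `&` `]0, 1[) x; last by case.
  rewrite stayE//; split => //=; move: x01; rewrite /= !in_itv/=.
  by move=> /andP[-> _].
have lo : mass v (stay n `&` avoid b (k + J)) <= mass v (U `&` avoid b (k + J)).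
  rewrite -[leLHS]mass_setI01; apply: le_mass_set => //; first exact: measurableI.
  by move=> x [[xs xa] x01]; split => //; apply: stayU.
have hi : mass v (U `&` avoid b (k + J)) <=
    mass v (stay n `&` avoid b (k + J)) + mass v `[endpoint n, b[%classic.
  rewrite -[leLHS]mass_setI01.
  have mD : measurable (`[endpoint n, b[ `\` (stay n `&` avoid b (k + J)) : set T).
    exact: measurableD.
  apply: (@le_trans _ _ (mass v ((stay n `&` avoid b (k + J)) `|`
      (`[endpoint n, b[ `\` (stay n `&` avoid b (k + J)))))).
    apply: le_mass_set => //; [exact: measurableI|exact: measurableU|].
    move=> x [[xU xa] x01].
    have [?|nsa] := pselect ((stay n `&` avoid b (k + J)) x); [by left|right].
    split => //; case: (cover x (conj xU x01)) => // xs.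
    by exfalso; apply: nsa.
  by rewrite mass_setU// ?setDIK// lerD2l; apply: le_mass_set => // x [].
have hiT : m <= mass v (stay n) + mass v `[endpoint n, b[%classic.
  rewrite /m -[leLHS]mass_setI01.
  have mD : measurable (`[endpoint n, b[ `\` stay n : set T) by exact: measurableD.
  apply: (@le_trans _ _ (mass v (stay n `|` (`[endpoint n, b[ `\` stay n)))).
    apply: le_mass_set => //; [exact: measurableI|exact: measurableU|].
    move=> x xU; have [?|nsa] := pselect (stay n x); [by left|right].
    by split => //; case: (cover x xU).
  by rewrite mass_setU// ?setDIK// lerD2l; apply: le_mass_set => // x [].
have loT : mass v (stay n) <= m.
  rewrite -[leLHS]mass_setI01.
  by apply: le_mass_set => //; exact: measurableI.
(* Mass below [endpoint n] is carried [n] steps to the left-branch image ]0, 1[, where it is regular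
   again; J - n steps remain to reach the right half. *)
have rn := regular_iter_Tl alpha01 n rv.
have := equidistribution k (J - n) bp (ltW b1') (ltW e10) (hb1 b bp bb1) rn.
rewrite mass_iter_Tl// mass_iter_Tl_stay// addnCA !subnKC//.
have -> : mass (iter n (Tl alpha) v) setT = mass v (stay n).
  by rewrite -[setT]/(stay 0) mass_iter_Tl_stay// addn0.
have JnJ : (J - n)%:R * b <= J%:R * b.
  by rewrite ler_wpM2r ?(ltW bp)// ler_nat leq_subr.
have th0 := survival_ge0 alpha b k; have th1 := survival_le1 alpha b k.
have s0 : 0 <= mass v (stay n) by exact: mass_ge0.
have h1 : (e1 + (J - n)%:R * (8 * b)) * mass v (stay n) <= 9 * e1 * m.
  apply: ler_pM => //; last by lra.
  by rewrite addr_ge0 ?(ltW e10)// !mulr_ge0// ltW.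
have h2 : mass v (stay n) * survival b k <= m * survival b k by rewrite ler_wpM2r.
have h3 : m * survival b k <= (mass v (stay n) + 4 * e1 * m) * survival b k.
  by rewrite ler_wpM2r//; lra.
have h4 : 4 * e1 * m * survival b k <= 4 * e1 * m.
  by rewrite ler_piMr// !mulr_ge0// ltW.
have h5 : e1 * m <= e / 100 * m by rewrite ler_wpM2r.
have h6 : 0 <= e * m by rewrite mulr_ge0// ltW.
rewrite !ler_norml => /andP[h7 h8]; apply/andP; split; lra.
Qed.

End equidistribution.

(** * Gates and neighbourhoods of 0 under the invariant measure *)

Section acip_estimates.
Context (R : realType) (alpha : R).
Hypothesis alpha01 : 0 < alpha < 1.
Variable mu : probability (measurableTypeR R) R.
Hypothesis hmu : acip (lsv alpha) mu.
Local Notation T := (measurableTypeR R).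
Local Notation f := (lsv alpha).
Local Notation one := (fun=> 1 : R).
Local Notation avoid := (avoid alpha).
Local Notation stay := (stay alpha).
Local Notation survival := (survival alpha).
Local Notation lpow := (lpow alpha).
Local Notation P := (prob mu).
Implicit Types (u v w g : R -> R) (x b e d : R).

Local Hint Resolve measurable_gate measurable_avoid measurable_stay
  measurable_lefth measurable_righth measurableT : core.

Let approxP e (E : set T) w : measurable E ->
  (forall E : set T, measurable E -> `|P E - mass w E| <= e) ->
  P E - e <= mass w E <= P E + e.
Proof. by move=> mE /(_ E mE); rewrite ler_norml => /andP[? ?]; apply/andP; split; lra. Qed.

(** Points lost are in the right half at time [M], which by invariance has the same probability at
    all times. *)
Lemma prob_stay_le M : P (stay M) <= P (stay M.+1) + P righth.
Proof.
have mp := measurable_pre alpha M (@measurable_righth R).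
have sub N : stay N `<=` stay N.+1 `|` pre alpha N righth.
  elim: N => [|N IH] x /=.
    move=> _; have [xl|xl] := pselect (lefth x); first by left; split.
    by right; rewrite -setC_lefth.
  by move=> [xl /IH[[? ?]|?]]; [left; do 2?split|right].
have -> : P righth = P (pre alpha M righth) by rewrite (prob_pre hmu).
have mD : measurable (pre alpha M righth `\` stay M.+1) by exact: measurableD.
apply: (@le_trans _ _ (P (stay M.+1 `|` (pre alpha M righth `\` stay M.+1)))).
  apply: prob_le => //; first exact: measurableU.
  move=> x /sub[?|?]; first by left.
  by have [?|?] := pselect (stay M.+1 x); [left|right].
by rewrite probU ?setDIK// lerD2l; apply: prob_le => // x [].
Qed.

(** Otherwise [stay M] would have probability 1 for all [M], whereas a regular approximation gives
    it little mass for large [M]. *)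
Lemma prob_righth_gt0 : 0 < P righth.
Proof.
have e0 : (0 : R) < 1 / 4 by lra.
have [w rw hw] := prob_regular_approx alpha01 hmu e0.
have [M hM] := mass_stay_small alpha01 rw e0.
have := approxP (measurable_stay alpha M) hw.
have claim N : 1 <= P (stay N) + N%:R * P righth.
  elim: N => [|N IH]; first by rewrite mul0r addr0 /prob probability_setT.
  have := prob_stay_le N; have -> : N.+1%:R = N%:R + 1 :> R by rewrite natr1.
  by rewrite mulrDl mul1r; lra.
have := claim M; rewrite lt_neqAle prob_ge0 andbT => h1 h2.
apply/eqP => h0; move: h1 h2; rewrite -h0 mulr0; lra.
Qed.

(** Applied with [e] the error of a regular approximation at fixed [b], it carries bounds over to
    [mu] without loss. *)
Let limit_le x y c : 0 <= c -> (forall e, 0 < e -> x <= y + c * e) -> x <= y.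
Proof.
move=> c0 h; apply/ler_addgt0Pr => e e0.
have c1 : 0 < c + 1 by rewrite ltr_pwDr.
have := h (e / (c + 1)); rewrite divr_gt0// => /(_ erefl)/le_trans; apply.
by rewrite lerD2l mulrCA ler_piMr ?(ltW e0)// ler_pdivrMr// mul1r lerDl.
Qed.

Lemma prob_gate_le b : 0 < b -> b <= 1 -> P (gate b) <= 4 * b.
Proof.
move=> b0 b1; apply: (@limit_le _ _ 5) => // e e0.
have [w [rw _] hw] := prob_regular_approx alpha01 hmu e0.
have := approxP (measurable_gate b) hw; have := approxP (@measurable_righth R) hw.
have := mass_gate_le b0 b1 rw; have := prob_le1 mu (@measurable_righth R).
rewrite (_ : 2 ^+ 2 = 4 :> R); last by ring.
move=> h1 h2 /andP[h3 h4] /andP[h5 h6].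
have h7 : 4 * b * mass w righth <= 4 * b * (1 + e) by apply: ler_wpM2l; lra.
have h8 : b * e <= 1 * e by rewrite ler_wpM2r// ltW.
lra.
Qed.

Lemma prob_gate_ge b : 0 < b -> b <= 1 -> b / 4 * P righth <= P (gate b).
Proof.
move=> b0 b1; apply: (@limit_le _ _ 2) => // e e0.
have [w [rw _] hw] := prob_regular_approx alpha01 hmu e0.
have := approxP (measurable_gate b) hw; have := approxP (@measurable_righth R) hw.
move=> /andP[h3 h4] /andP[h5 h6].
have dw := regular_density rw; have w0 := mass_ge0 righth dw.
have : mass w righth / 2 * mass one (gate b) <= mass w (gate b).
  apply: mass_ge_cst => //; first by rewrite divr_ge0.
  move=> x /gate_righth; rewrite /righth/= in_itv/= andbT => x2 _ x1.
  have := regular_inf rw x2 x1.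
  by rewrite (_ : 2 ^+ 2 = 4 :> R); [lra|ring].
rewrite mass1_gate// => h7.
have h8 : b * P righth <= b * (mass w righth + e) by apply: ler_wpM2l; lra.
have h9 : b * e <= 1 * e by rewrite ler_wpM2r// ltW.
lra.
Qed.

(** [mass_gate_avoid] chooses [b] and [J] before the density, so the approximation of [mu] may be
    refined at fixed [b] and the relative error survives. Removing the lag [J] costs 8 of the 9
    shares of [e]. *)
Lemma prob_gate_avoid e : 0 < e -> exists2 b0, 0 < b0 <= 1 &
  forall b, 0 < b -> b <= b0 -> forall k,
  `|P (gate b `&` f @^-1` avoid b k) - P (gate b) * survival b k| <=
  e * P (gate b).
Proof.
move=> e0; pose e1 := e / 9; have e10 : 0 < e1 by rewrite divr_gt0.
have [b0 /andP[b00 b01] hb0] := mass_gate_avoid alpha01 e10.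
exists b0; first by rewrite b00 b01.
move=> b bp bb0; have [J [Jb hJ]] := hb0 b bp bb0; have b1 := le_trans bb0 b01.
have mq i : measurable (gate b `&` f @^-1` avoid b i).
  by apply: measurableI => //; exact: measurable_lsv_preimage.
have m0 := prob_ge0 mu (gate b); set m := P (gate b) in m0 *.
have key k : `|P (gate b `&` f @^-1` avoid b (k + J)) - m * survival b k| <= e1 * m.
  apply: (@limit_le _ _ (2 + e1)); first by rewrite addr_ge0// ltW.
  move=> d d0; have [w [rw _] hw] := prob_regular_approx alpha01 hmu d0.
  have /andP[h1 h2] := approxP (measurable_gate b) hw.
  have /andP[h3 h4] := approxP (mq (k + J)%N) hw.
  have := hJ k w rw.
  have th0 := survival_ge0 alpha b k; have th1 := survival_le1 alpha b k.
  have h5 : (m - d) * survival b k <= mass w (gate b) * survival b k by rewrite ler_wpM2r.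
  have h6 : mass w (gate b) * survival b k <= (m + d) * survival b k by rewrite ler_wpM2r.
  have h7 : d * survival b k <= d * 1 by rewrite ler_wpM2l// ltW.
  have h8 : e1 * mass w (gate b) <= e1 * (m + d) by rewrite ler_wpM2l// ltW.
  by rewrite !ler_norml => /andP[h9 h10]; apply/andP; split; lra.
move=> k; have e1m : 0 <= e1 * m by rewrite mulr_ge0// ltW.
have eE : e * m = 9 * (e1 * m) by rewrite /e1; field.
have Jm : m * (J%:R * (8 * b)) <= 8 * (e1 * m).
  by have : m * (J%:R * b) <= m * e1 by [rewrite ler_wpM2l]; lra.
have h0 : P (gate b `&` f @^-1` avoid b (k + J)) <= P (gate b `&` f @^-1` avoid b k).
  apply: prob_le => // x [xg xa]; split => //.
  exact: (avoid_antitone (leq_addr _ _) xa).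
have /andP[s1 s2] := survival_shift alpha01 k J bp b1.
have := key k; rewrite ler_norml => /andP[lo1 lo2].
(* The lower bound comes from [key k]. For the upper bound, if k < J then survival is nearly 1 and
   the trivial bound [m] is enough; otherwise [key] applies at k - J. *)
have [kJ|Jk] := ltnP k J.
  have h1 : P (gate b `&` f @^-1` avoid b k) <= m by apply: prob_le => // x [].
  have /andP[t1 t2] := survival_shift alpha01 0 k bp b1.
  rewrite survival0 add0n in t2.
  have kJb : k%:R * b <= J%:R * b by rewrite ler_wpM2r ?(ltW bp)// ler_nat ltnW.
  have h2 : m * 1 <= m * (survival b k + k%:R * (8 * b)) by rewrite ler_wpM2l.
  have h3 : m * (k%:R * b) <= m * (J%:R * b) by rewrite ler_wpM2l.
  by rewrite ler_norml eE; apply/andP; split; lra.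
have := key (k - J)%N; rewrite subnK// ler_norml => /andP[l1 l2].
have /andP[t1 t2] := survival_shift alpha01 (k - J) J bp b1.
rewrite subnK// in t1 t2.
have h2 : m * survival b (k - J) <= m * (survival b k + J%:R * (8 * b)) by rewrite ler_wpM2l.
have h3 : m * survival b k <= m * survival b (k - J) by rewrite ler_wpM2l.
by rewrite ler_norml eE; apply/andP; split; lra.
Qed.

(** The error is absolute here, so one approximation [w] is fixed first; the waiting time [M]
    depends on [w], and [b] is then small compared with 1 / M. *)
Lemma prob_avoid_survival e : 0 < e -> exists2 b0, 0 < b0 <= 1 &
  forall b, 0 < b -> b <= b0 -> forall k, `|P (avoid b k) - survival b k| <= e.
Proof.
move=> e0; pose e1 := Num.min 1 (e / 100).
have e10 : 0 < e1 by rewrite lt_min ltr01 divr_gt0.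
have [e1h e1e] : e1 <= 1 /\ e1 <= e / 100.
  by split; rewrite ge_min lexx ?orbT.
have [w rw hw] := prob_regular_approx alpha01 hmu e10.
have [M hM] := mass_stay_small alpha01 rw e10.
have [b1 /andP[b10 b11] hb1] := forget_small alpha01 e10.
have M0 : (0 : R) < M.+1%:R by rewrite ltr0n.
pose b0 := Num.min b1 (e1 / M.+1%:R).
have b00 : 0 < b0 by rewrite lt_min b10 divr_gt0.
exists b0; first by rewrite b00 ge_min b11.
move=> b bp; rewrite le_min => /andP[bb1 bM] k; have b1' := le_trans bb1 b11.
have Mb : M%:R * b <= e1.
  move: bM; rewrite ler_pdivlMr//; apply: le_trans.
  by rewrite mulrC ler_wpM2l ?(ltW bp)// ler_nat.
have := equidistribution alpha01 k M bp b1' (ltW e10) (hb1 b bp bb1) rw.1.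
have /andP[h1 h2] := approxP (measurable_avoid alpha b (k + M)) hw.
have /andP[h3 h4] := approxP (@measurableT _ T) hw.
have PT : P setT = 1 by rewrite /prob probability_setT.
rewrite PT in h3 h4.
have th0 := survival_ge0 alpha b k; have th1 := survival_le1 alpha b k.
have wT0 := mass_ge0 setT (regular_density rw.1).
have g0 : 0 <= (e1 + M%:R * (8 * b)) by rewrite addr_ge0 ?mulr_ge0// ltW.
have h5 : (e1 + M%:R * (8 * b)) * mass w setT <= (9 * e1) * 2.
  by apply: ler_pM => //; lra.
have h6 : (1 - e1) * survival b k <= mass w setT * survival b k by rewrite ler_wpM2r.
have h7 : mass w setT * survival b k <= (1 + e1) * survival b k by rewrite ler_wpM2r.
have h8 : e1 * survival b k <= e1 * 1 by rewrite ler_wpM2l// ltW.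
have sh j : P (avoid b k) <= P (avoid b (k + j)) + j%:R * (4 * b).
  elim: j => [|j IH]; first by rewrite addn0 mul0r addr0.
  have mfa := measurable_lsv_preimage alpha (measurable_avoid alpha b (k + j)).
  have -> : j.+1%:R = j%:R + 1 :> R by rewrite natr1.
  have : P (avoid b (k + j)) <= P (avoid b (k + j.+1)) + P (gate b).
    rewrite -(prob_preimage hmu (measurable_avoid alpha b (k + j))).
    rewrite (probID mu mfa (measurable_gate b)) addrC addnS /= setIC lerD2l.
    by apply: prob_le; [exact: measurableI|by []|move=> x []].
  by have := prob_gate_le bp b1'; lra.
have h9 := sh M.
have h10 : P (avoid b (k + M)) <= P (avoid b k).
  by apply: prob_le => //; apply: avoid_antitone; exact: leq_addr.
rewrite !ler_norml => /andP[h11 h12]; apply/andP; split; lra.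
Qed.

(* By invariance the drop from avoid b n to avoid b n.+1 is the probability of
   being in the gate at time 0 and avoiding it at the times 1, ..., n, which is
   close to that of gate b times that of avoid b n. *)
Lemma prob_avoid_power e : 0 < e -> exists2 b0, 0 < b0 <= 1 &
  forall b, 0 < b -> b <= b0 -> forall n,
  `|P (avoid b n) - (1 - P (gate b)) ^+ n| <= e.
Proof.
move=> e0; have e20 : 0 < e / 2 by rewrite divr_gt0.
have [b1 /andP[b10 b11] h1] := prob_gate_avoid e20.
have [b2 /andP[b20 b21] h2] := prob_avoid_survival e20.
exists (Num.min b1 b2); first by rewrite lt_min b10 b20 ge_min b11.
move=> b bp; rewrite le_min => /andP[bb1 bb2].
have m0 := prob_ge0 mu (gate b); have m1 := prob_le1 mu (measurable_gate b).
set m := P (gate b) in m0 m1 *.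
elim=> [|n IH].
  by rewrite expr0 /= /prob probability_setT subrr normr0 ltW.
have mfa := measurable_lsv_preimage alpha (measurable_avoid alpha b n).
have step : P (avoid b n) = P (gate b `&` f @^-1` avoid b n) + P (avoid b n.+1).
  rewrite -[LHS](prob_preimage hmu (measurable_avoid alpha b n)).
  by rewrite (probID mu mfa (measurable_gate b)) /= !(setIC _ (f @^-1` _)).
have := h1 b bp bb1 n; have := h2 b bp bb2 n; rewrite -/m => h3 h4.
have h5 : m * `|P (avoid b n) - survival b n| <= m * (e / 2) by rewrite ler_wpM2l.
have h6 : (1 - m) * `|P (avoid b n) - (1 - m) ^+ n| <= (1 - m) * e.
  by rewrite ler_wpM2l// subr_ge0.
rewrite exprS.
have -> : P (avoid b n.+1) - (1 - m) * (1 - m) ^+ n =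
  (1 - m) * (P (avoid b n) - (1 - m) ^+ n) + m * (P (avoid b n) - survival b n)
  - (P (gate b `&` f @^-1` avoid b n) - m * survival b n).
  by rewrite step; ring.
apply: le_trans (ler_normB _ _) _; apply: (@le_trans _ _ (
  (1 - m) * `|P (avoid b n) - (1 - m) ^+ n| + m * `|P (avoid b n) - survival b n| +
  `|P (gate b `&` f @^-1` avoid b n) - m * survival b n|)).
  rewrite lerD2r; apply: le_trans (ler_normD _ _) _.
  by rewrite !normrM (ger0_norm m0) ger0_norm// subr_ge0.
lra.
Qed.

(** Within ]0, 1[ these two intervals are the parts of the preimage of [0, b[ under the two
    branches. *)
Lemma prob_ray_split b : 0 < b -> b <= 1 ->
  P `[0, b[%classic = P `[0, linv alpha b[%classic + P (gate b).
Proof.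
move=> b0 b1; have m0b c : measurable (`[0%R, c[%classic : set T) by exact: measurable_itv.
rewrite -[LHS](prob_preimage hmu (m0b b)).
have mf := measurable_lsv_preimage alpha (m0b b).
have mU : measurable (`[0, linv alpha b[ `|` gate b : set T) by exact: measurableU.
rewrite -probU//; last first.
  rewrite -subset0 => x [] /[swap] /gate_righth; rewrite /righth/= !in_itv/= andbT => x2.
  by move=> /andP[_ /lt_le_trans /(_ (linv_le_half alpha01 b))]; rewrite ltNge x2.
rewrite (prob_restrict hmu mf) [RHS](prob_restrict hmu mU).
congr (prob _ _); apply/seteqP; split => x [+ x01]; move: (x01);
  rewrite [X in X -> _]/= in_itv/= => /andP[x0 x1].
  rewrite [X in X -> _]/= in_itv/= => /andP[fx0 fxb]; split => //.
  have [x2|x2] := ltP x (1 / 2).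
    left; move: fxb; rewrite lsv_left//= in_itv/= (ltW x0)/=.
    by rewrite -linv_lt_iff// ltW.
  right; move: fx0 fxb; rewrite /gate lsv_right//= in_itv/= x2/= => _ h; lra.
move=> h; split => //; rewrite /= in_itv/=; case: h => /=; rewrite /gate/= in_itv/=.
  move=> /andP[_ xb]; have x2 := lt_le_trans xb (linv_le_half alpha01 b).
  rewrite lsv_left// -linv_lt_iff ?(ltW x0)// xb andbT.
  by rewrite mulr_ge0 ?addr_ge0 ?lpow_ge0// ltW.
by move=> /andP[x2 xb]; rewrite lsv_right//; lra.
Qed.

(* [0, b[ is the union of the [x_(j+1), x_j[ for x_j the j-th left preimage of
   b, each having the measure of gate (x_j); for fixed j, x_j / b tends to 1. *)
Lemma prob_ray_ge K : 0 < K -> exists2 b0, 0 < b0 <= 1 &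
  forall b, 0 < b -> b <= b0 -> K * b <= P `[0, b[%classic.
Proof.
move=> K0; have r0 := prob_righth_gt0; set r := P righth in r0.
(* Each of the [J] gates has measure at least b r / 8 by [prob_gate_ge], as long as its preimage of
   b is at least b / 2. *)
pose J := (Num.truncn (8 * K / r)).+1.
have J0 : (0 : R) < J%:R by rewrite ltr0n.
have KJ : K <= J%:R * r / 8.
  have : 8 * K / r < J%:R by exact: truncnS_gt.
  by rewrite ltr_pdivrMr//; lra.
have [d d0 hd] := @lpow_small R alpha alpha01 (1 / (2 * J%:R)) ltac:(by rewrite divr_gt0// mulr_gt0).
exists (Num.min 1 d); first by rewrite lt_min ltr01 d0 ge_min lexx.
move=> b bp; rewrite le_min => /andP[b1 bd].
have lb := hd b (ltW bp) bd; set s := lpow b in lb.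
have s0 : 0 <= s by exact: lpow_ge0.
pose x j := iter j (linv alpha) b.
have x0 j : 0 < x j by elim: j => //= j; exact: linv_gt0.
have xb j : x j <= b.
  elim: j => //= j IH; apply: le_trans (IH); apply/ltW/linv_lt => //.
  exact: le_trans IH b1.
have xlow j : b - j%:R * (b * s) <= x j.
  elim: j => [|j IH]; first by rewrite mul0r subr0.
  have xj1 := le_trans (xb j) b1.
  have := linvK alpha01 (x0 j) xj1; rewrite /lbranch -[linv alpha (x j)]/(x j.+1) => xE.
  have : x j.+1 * lpow (x j.+1) <= b * s.
    by apply: ler_pM; rewrite ?lpow_ge0 ?lpow_le// ltW.
  have -> : j.+1%:R = j%:R + 1 :> R by rewrite natr1.
  by lra.
have xhalf j : (j <= J)%N -> b / 2 <= x j.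
  move=> jJ; apply: le_trans (xlow j).
  have : j%:R * (b * s) <= J%:R * (b * s).
    by apply: ler_wpM2r; [rewrite mulr_ge0// ltW|rewrite ler_nat].
  have : b * (J%:R * s) <= b * (1 / 2).
    apply: ler_wpM2l; first exact: ltW.
    by move: lb; rewrite ler_pdivlMr ?mulr_gt0//; lra.
  by lra.
have claim j : (j <= J)%N -> j%:R * (b * r / 8) + P `[0, x j[%classic <= P `[0, b[%classic.
  elim: j => [|j IH] jJ; first by rewrite mul0r add0r.
  have xj1 := le_trans (xb j) b1.
  have := IH (ltnW jJ); rewrite (prob_ray_split (x0 j) xj1).
  have := prob_gate_ge (x0 j) xj1; rewrite -/r.
  have : b / 2 * r <= x j * r by rewrite ler_wpM2r ?xhalf ?(ltW r0)// ltnW.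
  have -> : j.+1%:R = j%:R + 1 :> R by rewrite natr1.
  by rewrite -[linv alpha (x j)]/(x j.+1); lra.
have := claim J (leqnn J); have := prob_ge0 mu `[0, x J[%classic.
have : K * b <= J%:R * r / 8 * b by rewrite ler_wpM2r// ltW.
by lra.
Qed.

Lemma prob_ray_small e : 0 < e -> exists2 b0, 0 < b0 &
  forall b, 0 < b -> b <= b0 -> P `[0, b[%classic <= e.
Proof.
move=> e0; have e20 : 0 < e / 2 by rewrite divr_gt0.
have [w [rw [B B0 wB]] hw] := prob_regular_approx alpha01 hmu e20.
have B1 : 0 < B + 1 by rewrite ltr_pwDr.
exists (Num.min 1 (e / 2 / (B + 1))); first by rewrite lt_min ltr01 !divr_gt0.
move=> b b0; rewrite le_min => /andP[b1 bB].
have m0b : measurable (`[0%R, b[%classic : set T) by exact: measurable_itv.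
have /andP[h1 h2] := approxP m0b hw.
have : mass w `[0, b[%classic <= B * mass one `[0, b[%classic.
  by apply: mass_le_cst => //; [exact: regular_density rw|move=> x _; exact: wB].
rewrite mass1_itv ?subr0 ?(ltW b0)// => h3.
by move: bB; rewrite ler_pdivlMr//; lra.
Qed.

End acip_estimates.
(** * Extremes *)

Section limits.
Context (R : realType).

Lemma cvg_of_natr_mul (p : nat -> R) (tau : R) : (forall n, 0 <= p n) ->
  n%:R * p n @[n --> \oo] --> tau -> p n @[n --> \oo] --> 0.
Proof.
move=> p0 ptau; apply/cvgrPdist_le => e e0.
have h1 : \forall n \near \oo, n%:R * p n <= `|tau| + 1.
  by apply: (cvgr_le _ ptau); rewrite ltr_pwDr// ler_norm.
have h2 : \forall n \near \oo, (`|tau| + 1) / e <= n%:R by exact: nbhs_infty_ger.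
near=> n; rewrite sub0r normrN ger0_norm//.
have : (`|tau| + 1) / e <= n%:R by near: n.
have : n%:R * p n <= `|tau| + 1 by near: n.
rewrite ler_pdivrMr// => l1 l2.
have n0 : 0 < n%:R :> R.
  rewrite lt_neqAle ler0n andbT; apply/eqP => n0; move: l2; rewrite -n0 mul0r.
  by have := normr_ge0 tau; lra.
by rewrite -(ler_pM2l n0); lra.
Unshelve. all: end_near. Qed.

(** Squeezed by exp (- m / (1 - m)) <= 1 - m <= exp (- m); the lower bound is 1 + t <= exp t at t =
    m / (1 - m). *)
Lemma cvg_onem_expn (m : nat -> R) (tau : R) :
  (forall n, 0 <= m n <= 1) -> n%:R * m n @[n --> \oo] --> tau ->
  (1 - m n) ^+ n @[n --> \oo] --> expR (- tau).
Proof.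
move=> m01 mtau.
have m0 : m n @[n --> \oo] --> 0.
  by apply: cvg_of_natr_mul mtau => n; case/andP: (m01 n).
have up : expR (- (n%:R * m n)) @[n --> \oo] --> expR (- tau).
  by apply: continuous_cvg; [exact: continuous_expR|exact: cvgN].
have lo : expR (- (n%:R * m n / (1 - m n))) @[n --> \oo] --> expR (- tau).
  apply: continuous_cvg; first exact: continuous_expR.
  have hd : 1 - m n @[n --> \oo] --> (1 - 0 : R) by apply: cvgB => //; exact: cvg_cst.
  have hV : (1 - m n)^-1 @[n --> \oo] --> ((1 - 0)^-1 : R).
    by apply: cvgV => //; rewrite subr0 oner_eq0.
  have : n%:R * m n / (1 - m n) @[n --> \oo] --> (tau * (1 - 0)^-1 : R).
    exact: cvgM.
  by rewrite subr0 invr1 mulr1; exact: cvgN.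
apply: (squeeze_cvgr _ lo up).
have h : \forall n \near \oo, m n <= 1 / 2 by apply: (cvgr_le _ m0); lra.
near=> n; have /andP[n0 n1] := m01 n.
have n2 : m n <= 1 / 2 by near: n.
have d0 : 0 < 1 - m n by lra.
have -> : - (n%:R * m n / (1 - m n)) = n%:R * - (m n / (1 - m n)) by ring.
have -> : - (n%:R * m n) = n%:R * - m n by ring.
rewrite !expRM_natl; apply/andP; split;
  rewrite lerXn2r ?nnegrE ?expR_ge0 ?(ltW d0)//; last exact: expR_ge1Dx.
rewrite expRN -[leRHS]invrK lef_pV2 ?posrE ?invr_gt0 ?expR_gt0//.
rewrite [leLHS](_ : _ = 1 + m n / (1 - m n)); last by field; rewrite gt_eqF.
exact: expR_ge1Dx.
Unshelve. all: end_near. Qed.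

End limits.

(** * From avoiding the gate to the maxima *)

Section extremes.
Context (R : realType) (alpha : R).
Hypothesis alpha01 : 0 < alpha < 1.
Variable mu : probability (measurableTypeR R) R.
Hypothesis hmu : acip (lsv alpha) mu.
Local Notation T := (measurableTypeR R).
Local Notation f := (lsv alpha).
Local Notation avoid := (avoid alpha).
Local Notation P := (prob mu).

Fixpoint above (b : R) n : set T :=
  if n is n'.+1 then ~` `[0, b[ `&` f @^-1` above b n' else setT.

Lemma measurable_above b n : measurable (above b n).
Proof.
elim: n => [|n IH] /=; first exact: measurableT.
apply: measurableI; last exact: measurable_lsv_preimage.
by apply: measurableC; exact: measurable_itv.
Qed.

Lemma lsv_unit (x : R) : 0 <= x <= 1 -> 0 <= f x <= 1.
Proof.
move=> /andP[x0 x1]; have [x2|x2] := ltP x (1 / 2).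
  rewrite lsv_left//; apply/andP; split.
    by rewrite mulr_ge0 ?addr_ge0 ?lpow_ge0.
  by rewrite -[leRHS](lbranch_half alpha) lbranch_le// ltW.
by rewrite lsv_right//; lra.
Qed.

(** A point in the gate at time i is in [0, b[ at time i + 1, whence the shift of the index. *)
Lemma above_avoid (b : R) n : above b n.+1 `<=` avoid b n.
Proof.
elim: n => [//|n IH] x [xb fx]; split; last exact: IH.
case: fx => fxb _; rewrite /gate /= in_itv/= => /andP[x2 xg]; apply: fxb.
by rewrite /= in_itv/= lsv_right//; lra.
Qed.

(** The left branch moves points up, so an orbit that starts at or above [b] can fall below it only
    from the gate. *)
Lemma avoid_above (b : R) n x : 0 <= x <= 1 -> b <= x -> avoid b n x -> above b n x.
Proof.
elim: n x => [//|n IH] x x01 bx [ng fa]; split.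
  by rewrite /= in_itv/= => /andP[_]; rewrite ltNge bx.
have [x0 _] := andP x01.
apply: IH => //; first exact: lsv_unit.
have [x2|x2] := ltP x (1 / 2).
  rewrite lsv_left//; apply: (le_trans bx).
  by rewrite /lbranch ler_peMr// lerDl lpow_ge0.
rewrite lsv_right// leNgt; apply/negP => h; apply: ng.
by rewrite /gate/= in_itv/= x2; lra.
Qed.

Lemma aboveP (b : R) n x :
  above b n x <-> forall i, (i < n)%N -> ~ `[0, b[%classic (iter i f x).
Proof.
elim: n x => [|n IH] x /=; first by split.
split=> [[xb /IH h] [|i] ilt //|h].
  by rewrite iterSr; exact: h.
split; first exact: (h 0%N).
by apply/IH => i ilt; have := h i.+1 ilt; rewrite iterSr.
Qed.

Section level.
Context (phi : R -> \bar R) (delta u : R).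
Hypothesis hu : level phi delta u.
Local Notation b := (obs_inv phi delta u).
Local Notation M := (max_le f phi).

Lemma level_gt0 : 0 < b.
Proof.
have [u0 _ exE] := hu.
have : exceedance phi u 0 by split => //; rewrite in_itv/= lexx ler01.
by rewrite exE /= in_itv/= => /andP[].
Qed.

Lemma level_le1 : b <= 1.
Proof.
have [_ _ exE] := hu; rewrite leNgt; apply/negP => b1.
have : exceedance phi u ((1 + b) / 2) by rewrite exE /= in_itv/=; lra.
by case; rewrite in_itv/= => + _; lra.
Qed.

Lemma max_leE n : M n u = `[0, 1] `&` above b n.
Proof.
have [_ _ exE] := hu.
have key y : y \in `[0, 1] -> (phi y <= u%:E)%E <-> ~ `[0, b[%classic y.
  move=> y01; rewrite -exE; split=> [yu [_]|yu]; first by rewrite ltNge yu.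
  by rewrite leNgt; apply/negP => h; apply: yu.
have itc x i : x \in `[0, 1] -> iter i f x \in `[0, 1].
  rewrite !in_itv/= => x01; elim: i => //= i; exact: lsv_unit.
apply/seteqP; split => x [x01 h]; split => //.
  apply/aboveP => i ilt; apply/key; first exact: itc.
  by have /bigmax_leP[_ /(_ (Ordinal ilt) erefl)] := h.
apply/bigmax_leP; split; first exact: leNye.
by move=> i _; apply/key; [exact: itc|move/aboveP : h; apply].
Qed.

Lemma measurable_max_le n : measurable (M n u).
Proof.
by rewrite max_leE; apply: measurableI => //; exact: measurable_above.
Qed.

Let mab n : measurable (avoid b n). Proof. exact: measurable_avoid. Qed.
Let mg : measurable (gate b). Proof. exact: measurable_gate. Qed.
Let mray (c : R) : measurable (`[0%R, c[%classic : set T).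
Proof. exact: measurable_itv. Qed.

Lemma prob_avoidS n : P (avoid b n) <= P (avoid b n.+1) + P (gate b).
Proof.
have mfa := measurable_lsv_preimage alpha (mab n).
rewrite -[leLHS](prob_preimage hmu (mab n)) (probID mu mfa mg) addrC /= setIC.
by rewrite lerD2l; apply: prob_le => [| |x []]//; exact: measurableI.
Qed.

(** Avoiding the gate does not exclude a start in [0, b[, whence the lower error; the gate precedes
    [0, b[ by one step, so the maximum up to time n leaves the gate at time n - 1 uncontrolled,
    whence the upper one. *)
Lemma prob_max_le n : P (avoid b n) - P `[0, b[%classic <= P (M n u)
  <= P (avoid b n) + P (gate b).
Proof.
have mM := measurable_max_le n; apply/andP; split; last first.
  case: n mM => [|n] mM.
    have -> : P (avoid b 0) = 1 by rewrite /prob probability_setT.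
    by have := prob_le1 mu mM; have := prob_ge0 mu (gate b); lra.
  apply: le_trans (prob_avoidS n); apply: prob_le => //.
  by rewrite max_leE => x [_]; exact: above_avoid.
have mI : measurable (avoid b n `&` `]0, 1[) by exact: measurableI.
have mD : measurable (`[0, b[ `\` M n u) by exact: measurableD.
have mU : measurable (M n u `|` (`[0, b[ `\` M n u)) by exact: measurableU.
rewrite lerBlDr (prob_restrict hmu)//.
apply: (@le_trans _ _ (P (M n u `|` (`[0, b[ `\` M n u)))).
  apply: prob_le => // x [xa x01]; have [?|xM] := pselect (M n u x); first by left.
  right; split => //; move: x01; rewrite /= !in_itv/= => /andP[x0 x1].
  rewrite (ltW x0)/= ltNge; apply/negP => bx; apply: xM; rewrite max_leE.
  split; first by rewrite /= in_itv/= !ltW.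
  by apply: avoid_above => //; rewrite !ltW.
by rewrite probU ?setDIK// lerD2l; apply: prob_le => // x [].
Qed.

Lemma prob_avoid_ge n : 1 - n%:R * P (gate b) <= P (avoid b n).
Proof.
elim: n => [|n IH]; first by rewrite mul0r subr0 /prob probability_setT.
have := prob_avoidS n; have -> : n.+1%:R = n%:R + 1 :> R by rewrite natr1.
by lra.
Qed.

End level.

(** On the right branch 2 x - 1 <= x, so a preimage of [b] below [b] belongs to the left branch. *)
Lemma level_preimage (b x : R) : 0 < b -> x \in `[0, 1] -> x < b ->
  f x = b -> x = linv alpha b.
Proof.
rewrite in_itv/= => b0 /andP[x0 x1] xb fx.
have x2 : x < 1 / 2.
  by rewrite ltNge; apply/negP => x2; move: fx; rewrite lsv_right//; lra.
move: fx; rewrite lsv_left// => fx.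
have x0' : 0 < x.
  by rewrite lt_neqAle x0 andbT; apply/eqP => h; move: fx b0; rewrite -h lbranch0; lra.
by rewrite -fx lbranchK// ltW.
Qed.

Lemma prob_gateE (b : R) : 0 < b -> b <= 1 ->
  P (gate b) = P `[linv alpha b, b[%classic.
Proof.
move=> b0 b1; have := prob_ray_split alpha01 hmu b0 b1.
have m (c d : R) : measurable (`[c, d[%classic : set T) by exact: measurable_itv.
have l0 := linv_gt0 alpha01 b0; have lb := linv_lt alpha01 b0 b1.
have -> : `[0, b[%classic = `[0, linv alpha b[ `|` `[linv alpha b, b[ :> set T.
  apply/seteqP; split => x /=; rewrite !in_itv/=.
    by move=> /andP[x0 xb]; have [?|?] := ltP x (linv alpha b); [left|right];
      apply/andP.
  by move=> [|] /andP[? ?]; apply/andP; split; lra.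
rewrite probU//; first by lra.
by rewrite -subset0 => x [/=]; rewrite !in_itv/= => /andP[_ +] /andP[+ _]; lra.
Qed.

End extremes.

Theorem theorem2 (R : realType) (alpha : R) (halpha : 0 < alpha < 1)
    (mu : probability (measurableTypeR R) R) (hmu : acip (lsv alpha) mu)
    (phi : R -> \bar R) (delta : R) (hphi : observable phi delta) :
  (forall (tau : R) (u : nat -> R),
     0 < tau ->
     (forall n, level phi delta (u n)) ->
     (n%:R%:E * mu (exceedance phi (u n)))%E @[n --> \oo] --> tau%:E ->
     mu (max_le (lsv alpha) phi n (u n)) @[n --> \oo] --> 1%E)
  /\
  (alpha < Num.sqrt 5 - 2 ->
   forall (tau : R) (u x : nat -> R),
     0 <= tau ->
     (forall n, level phi delta (u n)) ->
     (forall n, [/\ x n \in `[0, 1],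
                    x n < obs_inv phi delta (u n)
                  & lsv alpha (x n) = obs_inv phi delta (u n)]) ->
     (n%:R%:E * mu `[x n, obs_inv phi delta (u n)[%classic)%E
       @[n --> \oo] --> tau%:E ->
     mu (max_le (lsv alpha) phi n (u n)) @[n --> \oo] --> (expR (- tau))%:E).
Proof.
pose b (u : nat -> R) n := obs_inv phi delta (u n).
have r0 := prob_righth_gt0 halpha hmu.
(* The gate has measure at least a fixed multiple of [b], so a vanishing measure forces [b] to 0. *)
have small u : (forall n, level phi delta (u n)) ->
    prob mu (gate (b u n)) @[n --> \oo] --> 0 ->
    forall c, 0 < c -> \forall n \near \oo, b u n <= c.
  move=> lu g0 c c0.
  have cr : 0 < c / 4 * prob mu righth by rewrite mulr_gt0// divr_gt0.
  have h : \forall n \near \oo, prob mu (gate (b u n)) < c / 4 * prob mu righth.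
    exact: (cvgr_lt _ g0).
  near=> n; rewrite leNgt; apply/negP => cb.
  have : prob mu (gate (b u n)) < c / 4 * prob mu righth by near: n.
  have := prob_gate_ge halpha hmu (level_gt0 (lu n)) (level_le1 (lu n)).
  have : c * prob mu righth <= b u n * prob mu righth by rewrite ler_wpM2r// ltW.
  by rewrite -/(b u n); lra.
have goal_cvg u (l : R) : (forall n, level phi delta (u n)) ->
    prob mu (max_le (lsv alpha) phi n (u n)) @[n --> \oo] --> l ->
    mu (max_le (lsv alpha) phi n (u n)) @[n --> \oo] --> l%:E.
  move=> lu h; apply: cvg_EFin; last exact: h.
  near=> n; apply: fin_num_measure; exact: (measurable_max_le halpha (lu n)).
split.
- move=> tau u tau0 lu htau.
  have ray : n%:R * prob mu `[0, b u n[%classic @[n --> \oo] --> tau.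
    apply: cvg_trans (fine_cvg htau); apply: near_eq_cvg; near=> n.
    have [_ _ exE] := lu n; rewrite /= exE -/(b u n).
    by rewrite probE ?fineM//; exact: measurable_itv.
  have ray0 := cvg_of_natr_mul (fun n => prob_ge0 mu _) ray.
  have gate_ray n : prob mu (gate (b u n)) <= prob mu `[0, b u n[%classic.
    rewrite [leRHS](prob_ray_split halpha hmu (level_gt0 (lu n)) (level_le1 (lu n))).
    by rewrite lerDr prob_ge0.
  have gate0 : prob mu (gate (b u n)) @[n --> \oo] --> 0.
    apply: (squeeze_cvgr _ (cvg_cst 0) ray0).
    by near=> n; rewrite prob_ge0 gate_ray.
  have bsmall := small u lu gate0.
  have ngate0 : n%:R * prob mu (gate (b u n)) @[n --> \oo] --> 0.
    apply/cvgrPdist_le => e e0.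
    (* The gate has measure at most 4 b, while for this constant [0, b[ has measure at least 4 b
       (tau + 1) / e and n times that is at most tau + 1; so n times the former is at most e. *)
    have K0 : 0 < 4 * (tau + 1) / e by rewrite divr_gt0// mulr_gt0// ltr_pwDr// ltW.
    have [c /andP[c0 c1] hc] := prob_ray_ge halpha hmu K0.
    have hb := bsmall c c0.
    have hray : \forall n \near \oo, n%:R * prob mu `[0, b u n[%classic <= tau + 1.
      by apply: (cvgr_le _ ray); rewrite ltrDl.
    near=> n; rewrite sub0r normrN ger0_norm ?mulr_ge0 ?prob_ge0//.
    have bn0 : 0 < b u n := level_gt0 (lu n).
    have bnc : b u n <= c by near: n.
    have h1 := hc _ bn0 bnc.
    have h2 : n%:R * prob mu `[0, b u n[%classic <= tau + 1 by near: n.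
    have h3 := prob_gate_le halpha hmu bn0 (level_le1 (lu n)).
    have h4 : n%:R * prob mu (gate (b u n)) <= n%:R * (4 * b u n) by rewrite ler_wpM2l.
    have h5 : n%:R * (4 * (tau + 1) / e * b u n) <= tau + 1.
      by apply: le_trans h2; rewrite ler_wpM2l.
    apply: (le_trans h4).
    have t1 : 0 < (tau + 1) / e by rewrite divr_gt0// ltr_pwDr// ltW.
    rewrite -(ler_pM2l t1) [leLHS](_ : _ = n%:R * (4 * (tau + 1) / e * b u n)).
      by rewrite divfK// gt_eqF.
    by field; rewrite gt_eqF.
  apply: goal_cvg => //.
  have lo : 1 - n%:R * prob mu (gate (b u n)) - prob mu `[0, b u n[%classic
      @[n --> \oo] --> (1 - 0 - 0 : R).
    by apply: cvgB => //; apply: cvgB => //; exact: cvg_cst.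
  rewrite !subr0 in lo.
  have hi : (1 : R) @[_ --> \oo] --> (1 : R) by exact: cvg_cst.
  apply: (squeeze_cvgr _ lo hi).
  near=> n; have mM := measurable_max_le halpha (lu n) n.
  rewrite prob_le1// andbT.
  have /andP[h _] := prob_max_le halpha hmu (lu n) n.
  have := prob_avoid_ge hmu phi delta (u n) n.
  by rewrite /b; lra.
- move=> _ tau u x tau0 lu hx htau.
  have gateE n : prob mu (gate (b u n)) = prob mu `[x n, b u n[%classic.
    have [x01 xb fx] := hx n; have b0 := level_gt0 (lu n).
    by rewrite (prob_gateE halpha hmu b0 (level_le1 (lu n))) (level_preimage halpha b0 x01 xb fx).
  have gate_tau : n%:R * prob mu (gate (b u n)) @[n --> \oo] --> tau.
    apply: cvg_trans (fine_cvg htau); apply: near_eq_cvg; near=> n.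
    rewrite /= gateE -/(b u n).
    by rewrite probE ?fineM//; exact: measurable_itv.
  have gate0 := cvg_of_natr_mul (fun n => prob_ge0 mu _) gate_tau.
  have bsmall := small u lu gate0.
  have power : (1 - prob mu (gate (b u n))) ^+ n @[n --> \oo] --> expR (- tau).
    apply: cvg_onem_expn => // n.
    by rewrite prob_ge0 prob_le1//; exact: measurable_gate.
  apply: goal_cvg => //; apply/cvgrPdist_le => e e0.
  have e4 : 0 < e / 4 by rewrite divr_gt0.
  have [c /andP[c0 c1] hc] := prob_avoid_power halpha hmu e4.
  have [d d0 hd] := prob_ray_small halpha hmu e4.
  have hbc := bsmall c c0; have hbd := bsmall d d0.
  have hg : \forall n \near \oo, prob mu (gate (b u n)) <= e / 4 by apply: (cvgr_le _ gate0).
  have /cvgrPdist_le/(_ _ e4) hp := power.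
  near=> n; have bn0 : 0 < b u n := level_gt0 (lu n).
  have bnc : b u n <= c by near: n.
  have bnd : b u n <= d by near: n.
  have h1 : prob mu (gate (b u n)) <= e / 4 by near: n.
  have h2 : `|expR (- tau) - (1 - prob mu (gate (b u n))) ^+ n| <= e / 4 by near: n.
  have h3 := hc _ bn0 bnc n; have h4 := hd _ bn0 bnd.
  have /andP[h5 h6] := prob_max_le halpha hmu (lu n) n.
  move: h2 h3; rewrite -/(b u n) in h5 h6.
  by rewrite !ler_norml => /andP[? ?] /andP[? ?]; apply/andP; split; lra.
Unshelve. all: end_near. Qed.
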